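(* Let $p,q,r,s$ be distinct primes such that $p \equiv q \equiv 3 \pmod 4$ and $r \equiv s \equiv 1 \pmod 4$. Then the bi-quadratic field $\mathbb{Q}(\sqrt{2p}, \sqrt{2qrs})$ is a Pólya field if $$\left(\frac{2}{s}\right) = \left(\frac{q}{r}\right) = \left(\frac{s}{r}\right) = \left(\frac{p}{r}\right) = -1 \quad\text{and}\quad \left(\frac{q}{s}\right) = \left(\frac{p}{s}\right) = 1.$$
   Context: Here $\left(\frac{a}{\ell}\right)$ is the Legendre symbol for an odd prime $\ell$. For a number field $K$ with ring of integers $\mathcal{O}_K$, a prime number $\ell$ and an integer $f\ge 1$, the Ostrowski ideal $\Pi_{\ell^f}(K)$ is the product of all maximal ideals $\mathfrak{m}$ of $\mathcal{O}_K$ with norm $N_{K/\mathbb{Q}}(\mathfrak{m}) = \ell^f$ (equal to $\mathcal{O}_K$ if there are none). The Pólya group $Po(K)$ is the subgroup of the ideal class group of $K$ generated by the classes of all Ostrowski ideals of $K$. $K$ is a Pólya field if all its Ostrowski ideals are principal, equivalently if $Po(K)$ is trivial. *)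

(* Defs.v *)
From HB Require Import structures.
From mathcomp Require Import all_boot all_order all_algebra all_field.
From mathcomp Require Import boolp classical_sets functions cardinality fsbigop.

Set Implicit Arguments.
Unset Strict Implicit.
Unset Printing Implicit Defensive.

Import GRing.Theory.

Local Open Scope classical_set_scope.
Local Open Scope ring_scope.

(* Meaningful for l an odd prime only: 'F_l is the field with l elements
   precisely when l is prime. *)
Definition legendre (a : int) (l : nat) : int :=
  let x := a%:~R : 'F_l in
  if x == 0 then 0 else if [exists y : 'F_l, y ^+ 2 == x] then 1 else -1.

Section RingOfIntegers.
Variable K : fieldExtType rat.

Definition integral_over_Z : {pred K} :=
  fun x => `[< integralOver (intr : int -> K) x >].

Fact integral_over_Z_subring : subring_closed integral_over_Z.
Proof.
split=> [|x y /asboolP xZ /asboolP yZ|x y /asboolP xZ /asboolP yZ];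
  apply/asboolP.
- exact: integral1.
- exact: integral_sub.
- exact: integral_mul.
Qed.

HB.instance Definition _ :=
  GRing.isSubringClosed.Build K integral_over_Z integral_over_Z_subring.

Record integers := Integers {
  integers_val :> K;
  integers_valP : integers_val \in integral_over_Z
}.

HB.instance Definition _ := [isSub for integers_val].
HB.instance Definition _ := [Choice of integers by <:].
HB.instance Definition _ := [SubChoice_isSubComNzRing of integers by <:].

End RingOfIntegers.

Section Ideals.
Variable R : comNzRingType.
Implicit Types I J M : set R.

(* [idealr_closed] only accepts proper ideals. *)
Definition maximal_ideal M : Prop :=
  idealr_closed [in M] /\
  forall J, idealr_closed [in J] -> M `<=` J -> J = M.

Definition ideal_mul I J : set R :=
  [set x | exists2 s : seq (R * R),
     {in s, forall u, I u.1 /\ J u.2} & x = \sum_(u <- s) u.1 * u.2].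

Definition principal_ideal I : Prop :=
  exists g : R, I = [set g * x | x in setT].

Definition cosets I : set (set R) := [set [set x + y | y in I] | x in setT].

(* The absolute norm: the quotient ring R / I has exactly n elements. *)
Definition has_norm I (n : nat) : Prop := (cosets I #= `I_n)%card.

End Ideals.

(* The big operator would return the unit ideal on an infinite index set, but
   a number field has only finitely many maximal ideals of a given norm. *)
Definition ostrowski_ideal (K : fieldExtType rat) (l f : nat) :
    set (integers K) :=
  \big[@ideal_mul (integers K) / setT]_(M \in
      [set M : set (integers K) | maximal_ideal M /\ has_norm M (l ^ f)]) M.

Arguments ostrowski_ideal K l f : clear implicits.

Definition polya_field (K : fieldExtType rat) : Prop :=
  forall l f : nat, prime l -> (1 <= f)%N ->
    principal_ideal (ostrowski_ideal K l f).

(* Main.v *)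
Require Import Defs.
From HB Require Import structures.
From mathcomp Require Import all_boot all_order all_algebra all_fingroup.
From mathcomp Require Import all_solvable all_field.
From mathcomp Require Import boolp classical_sets functions cardinality fsbigop.
From mathcomp Require Import finmap zify ring.

(** Let K be generated by a and b with a^2 = 2p, b^2 = 2qrs, and put
    c = ab/2, so that c^2 = pqrs and the quadratic subfields of K are Q(a),
    Q(b) and Q(c).  As pqrs = 1 mod 4, exactly 2, p, q, r, s ramify, each with
    index 2.

    The Ostrowski ideal of a prime l at any exponent is either the unit ideal
    or the intersection I of all maximal ideals of some norm l^f
    ([prod_maximal]).  Such an I contains l, meets Z in lZ and is stable under
    Gal(K/Q).  An element t of I lying in a quadratic subfield satisfies
    t^2 = T t - N with T and N divisible by l, so
    t^2 / l is integral ([stable_quadratic]).  Writing an element of I through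
    its relative traces to a quadratic subfield over which K is unramified at l
    ([trace_reduction]) gives I = lO when l is unramified, and I = gamma O as
    soon as l = gamma^2 e with a unit e ([ramified_stable]).

    It remains to write 2, p, q, r, s as squares times units in K.  The numbers
    with this property form a group, which contains 2p, 2qrs and pqrs.  More
    members come from Pell's equation: the least solution of
    x^2 = N y^2 + 1 yields N = D D' and D u^2 = D' v^2 + 1 with D <> 1
    ([pell_descent]), and then (D u + v sqrt N)^2 is D times a unit of norm 1
    ([descent_square_times_unit]).  Modulo r and modulo s,
    the equation forces the factor D or D' that is prime to the modulus to be a
    square; modulo a prime that is 3 mod 4 it excludes D = N.  Together with the
    residue symbols and the reciprocity (r/s) = (s/r) = -1 this leaves only
    D = 2 or p for N = 2p, D = 2r or qs for N = 2qrs, and D = pq or rs for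
    N = pqrs ([descent_2p], [descent_2qrs], [descent_pqrs]).  So 2, p, r, qs, q
    and s all belong to the group.

    Reciprocity is proved with the quadratic Gauss sum
    ([reciprocity_1mod4]), and Pell's equation is solved by following
    the periodic river of Conway's topograph of x^2 - N y^2
    ([river_periodic]). *)

Set Implicit Arguments.
Unset Strict Implicit.
Unset Printing Implicit Defensive.

Import Order.TTheory GRing.Theory Num.Theory.

Local Open Scope ring_scope.

(** * Pell's equation *)

(** The triple (A, B, C) stands for the indefinite form A x^2 + 2 B x y - C y^2. *)
Definition form : Type := (int * int * int)%type.

(** One step along the river of the topograph: the basis e1, e2, on which the
    form has values of opposite signs, is replaced by e1 + e2, e2 or by
    e1, e1 + e2 according to the sign of the value A + 2 B - C at e1 + e2, so
    that the signs stay opposite. *)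
Definition river_step (f : form) : form :=
  let: (A, B, C) := f in
  if 0 < A + 2 * B - C then (A + 2 * B - C, B - C, C)
  else (A, B + A, C - 2 * B - A).

Definition river_form (N : nat) (f : form) : Prop :=
  let: (A, B, C) := f in [/\ 0 < A, 0 < C & B * B + A * C = N%:Z].

Definition nonsquare (N : nat) : Prop := forall m : nat, (m * m)%N <> N.

(** The value at e1 + e2 does not vanish: otherwise C = A + 2 B and the
    determinant would be (A + B)^2. *)
Lemma river_step_form N f :
  nonsquare N -> river_form N f -> river_form N (river_step f).
Proof.
move=> Nsq; case: f => [[A B] C] [A0 C0 E] /=.
case: ifPn => h; split; rewrite -?E //; try by ring.
have : A + 2 * B - C != 0.
  apply/eqP=> h0; suff: (absz (A + B)%R * absz (A + B)%R)%N = N by exact: Nsq.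
  have C_eq : C = A + 2 * B by lia.
  have : N%:Z = (A + B) * (A + B) by rewrite -E C_eq; ring.
  nia.
lia.
Qed.

(** The sign of A' - 2 B' - C' at the new form tells which of the two branches
    was taken, hence the step can be undone. *)
Lemma river_step_inj N f g : river_form N f -> river_form N g ->
  river_step f = river_step g -> f = g.
Proof.
case: f g => [[A B] C] [[A' B'] C'] [A0 C0 _] [A0' C0' _] /=.
by case: ifP => h; case: ifP => h' [] e1 e2 e3; repeat congr pair; lia.
Qed.

(** There are finitely many river forms of determinant N, and an injective step
    on a finite set brings every starting point back to itself. *)
Lemma river_periodic N : (0 < N)%N -> nonsquare N ->
  exists2 k, (0 < k)%N & iter k river_step (1, 0, N%:Z) = (1, 0, N%:Z).
Proof.
move=> N0 Nsq; set f0 : form := (1, 0, N%:Z).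
pose it k := iter k river_step f0.
have itP k : river_form N (it k).
  by elim: k => [|k IH]; [split; lia | exact: river_step_form].
pose T : finType := ('I_(2 * N).+1 * 'I_(2 * N).+1 * 'I_(2 * N).+1)%type.
pose code (f : form) : T :=
  let: (A, B, C) := f in (inord (absz A), inord (absz (B + N%:Z)%R), inord (absz C)).
have code_inj f g : river_form N f -> river_form N g -> code f = code g -> f = g.
  have bnd A B C : 0 < A -> 0 < C -> B * B + A * C = N%:Z ->
      [/\ A <= N%:Z, C <= N%:Z, - N%:Z <= B & B <= N%:Z].
    by move=> *; split; nia.
  case: f g => [[A B] C] [[A' B'] C'] [A0 C0 E] [A0' C0' E'].
  have [? ? ? ?] := bnd _ _ _ A0 C0 E; have [? ? ? ?] := bnd _ _ _ A0' C0' E'.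
  case=> /(congr1 val) + /(congr1 val) + /(congr1 val).
  rewrite /= !inordK; try lia.
  by move=> *; repeat congr pair; lia.
have [i [j ij /code_inj e]] : exists i : 'I_(#|T|).+1, exists2 j : 'I_(#|T|).+1,
    (i < j)%N & code (it i) = code (it j).
  have /injectivePn[i [j ij e]] : ~~ injectiveb (fun i : 'I_(#|T|).+1 => code (it i)).
    by apply/injectiveP=> /leq_card; rewrite card_ord ltnn.
  by case: (ltngtP i j) => [h|h|/val_inj h]; [exists i, j|exists j, i|rewrite h eqxx in ij].
(* A coincidence at times i < j is pulled back by injectivity to 0 and j - i. *)
have {e} := e (itP i) (itP j); elim: (i : nat) (j : nat) ij => [|m IH] [//|n] mn.
  by move=> e; exists n.+1.
by move=> /(river_step_inj (itP m) (itP n)); exact: IH.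
Qed.

(** The current form is x^2 - N y^2 written in the basis e1 = (x, y),
    e2 = (z, t).  The sum of the coordinates increases at each step, so the
    river never returns to the initial basis, even when it returns to the
    initial form. *)
Lemma river_basis N k : exists x y z t : int,
  [/\ [/\ 0 <= x, 0 <= y, 0 <= z & 0 <= t], x * t - z * y = 1,
      k%:Z + 2 <= x + y + z + t &
      iter k river_step (1, 0, N%:Z) =
        (x * x - N%:Z * (y * y), x * z - N%:Z * (y * t),
         N%:Z * (t * t) - z * z)].
Proof.
elim: k => [|k [x [y [z [t [[x0 y0 z0 t0] d b]]]]]] /=.
  by exists 1, 0, 0, 1; split=> //; repeat congr pair; lia.
move=> ->; rewrite /river_step; case: ifP => _.
- exists (x + z), (y + t), z, t; split; [split; lia|lia|nia|].
  by repeat congr pair; ring.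
- exists x, y, (x + z), (y + t); split; [split; lia|lia|nia|].
  by repeat congr pair; ring.
Qed.

(** When the river comes back to the form (1, 0, N), the vector e1 has value 1.
    If its second coordinate were 0, the basis would be the initial one, which
    the growth of the coordinates excludes. *)
Theorem pell_solution N : (0 < N)%N -> nonsquare N ->
  exists x y : nat, (0 < y)%N /\ (x * x = N * (y * y) + 1)%N.
Proof.
move=> N0 Nsq; have [k k0] := river_periodic N0 Nsq.
have [x [y [z [t [[x0 y0 z0 t0] d b ->]]]]] := river_basis N k.
case=> e1 e2 _; exists (absz x), (absz y); split; last by lia.
have : y <> 0 by move=> h; subst y; nia.
lia.
Qed.

(** Indeed gcd(A, w)^2 = gcd(A^2, A w, w^2) = A gcd(A, B, w). *)
Lemma coprime_mul_square A B w : coprime A B -> (A * B = w * w)%N ->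
  A = (gcdn A w * gcdn A w)%N.
Proof.
move=> cAB E.
have -> : (gcdn A w * gcdn A w = A * gcdn (gcdn A B) w)%N.
  rewrite -gcdnA muln_gcdl !muln_gcdr -E [(w * A)%N]mulnC.
  by rewrite -gcdnA [gcdn (A * w) (gcdn _ _)]gcdnA gcdnn [gcdn (A * w) _]gcdnC.
by rewrite (eqP cAB) gcd1n muln1.
Qed.

(** In the least solution of x^2 = N y^2 + 1 the congruence on N makes y = 2 w
    even and x = 2 z + 1 odd, so z (z + 1) = N w^2.  As z and z + 1 are coprime,
    N splits as D D' with z + 1 = D u^2 and z = D' v^2.  If D were 1, then
    u^2 = N v^2 + 1 would be a smaller solution. *)
Lemma pell_descent N : nonsquare N -> (N %% 4 == 1)%N || (N %% 4 == 2)%N ->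
  exists D D' u v : nat,
    [/\ (D * D' = N)%N, (D * (u * u) = D' * (v * v) + 1)%N & D <> 1%N].
Proof.
move=> Nsq N4; have N0 : (0 < N)%N by lia.
pose P y := (0 < y)%N && [exists x : 'I_(N * (y * y)).+2, (x * x == N * (y * y) + 1)%N].
have [y0 Py0] : exists y, P y.
  have [x [y [y0 E]]] := pell_solution N0 Nsq; exists y; rewrite /P y0 /=.
  have xb : (x < (N * (y * y)).+2)%N by nia.
  by apply/existsP; exists (Ordinal xb); rewrite /= E.
case: (ex_minnP (ex_intro P y0 Py0)) => y /andP[y_gt0 /existsP[[x /= _] /eqP E]] ymin.
have [w yE] : exists w, y = (2 * w)%N.
  exists y./2; suff : ~~ odd y by lia.
  apply/negP=> yodd.
  have [k yE] : exists k, y = (2 * k + 1)%N by exists y./2; lia.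
  have [j xE] : exists j, x = (2 * j + odd x)%N by exists x./2; lia.
  have [i NE] : exists i, N = (4 * i + N %% 4)%N by exists (N %/ 4)%N; lia.
  (* If y is odd, then x^2 = N + 1 modulo 4, which is 2 or 3. *)
  have e1 : (x * x = 4 * (j * j + j * odd x) + odd x)%N by case: (odd x) xE => /= ->; lia.
  have e2 : (y * y = 4 * (k * k + k) + 1)%N by rewrite yE; lia.
  have e3 : (N * (y * y) = 4 * (i * (y * y) + (N %% 4) * (k * k + k)) + N %% 4)%N.
    rewrite {1}NE; transitivity (4 * (i * (y * y)) + (N %% 4) * (y * y))%N; first by ring.
    by rewrite [in X in (_ + X)%N]e2; ring.
  by rewrite e3 e1 in E; case/orP: N4 => /eqP h; rewrite h in E; case: (odd x) E => /=; lia.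
have [z xE] : exists z, x = (2 * z + 1)%N.
  exists x./2; suff : odd x by lia.
  by have := congr1 odd E; rewrite oddM yE andbb oddD !oddM /= andbF => ->.
subst x y; have zE : (z.+1 * z = N * (w * w))%N by nia.
have co : coprime z.+1 z by rewrite coprimeSn.
set D := gcdn z.+1 N; set D' := gcdn z N.
have DD : (D * D' = N)%N.
  apply/eqP; rewrite eqn_dvd Gauss_dvd ?dvdn_gcdr /=; last first.
    by apply: coprime_dvdl (coprime_dvdr _ co); exact: dvdn_gcdl.
  rewrite muln_gcdl !muln_gcdr !dvdn_gcd zE.
  by do ![apply/andP; split]; first [exact: dvdn_mulr | exact: dvdn_mull].
have [[A hA] [B hB]] : (exists A, z.+1 = D * A)%N /\ (exists B, z = D' * B)%N.
  by split; [have /dvdnP[A ->] := dvdn_gcdl z.+1 N|have /dvdnP[B ->] := dvdn_gcdl z N];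
     eexists; rewrite mulnC.
have D0 : (0 < D)%N by rewrite gcdn_gt0.
have AB : (A * B = w * w)%N.
  by apply/eqP; rewrite -(eqn_pmul2l N0) -zE {1}hA {1}hB -DD; apply/eqP; ring.
have cAB : coprime A B.
  by apply: coprime_dvdl (coprime_dvdr _ co); rewrite ?hA ?hB dvdn_mull.
have hA2 := coprime_mul_square cAB AB.
have hB2 : B = (gcdn B w * gcdn B w)%N.
  by apply: (@coprime_mul_square B A); rewrite 1?coprime_sym // mulnC.
exists D, D', (gcdn A w), (gcdn B w); split=> //.
  by rewrite -hA2 -hB2 -hA -hB addn1.
move=> D1; have D'N : D' = N by rewrite -DD D1 mul1n.
move: hA hB; rewrite D1 D'N mul1n hA2 hB2 => zu zv.
have uv : w = (gcdn A w * gcdn B w)%N.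
  by apply/eqP; rewrite -(@eqn_exp2r _ _ 2) // -!mulnn -AB {1}hA2 {1}hB2; apply/eqP; ring.
move: (gcdn A w) (gcdn B w) zu zv uv => u v zu zv uv.
have v0 : (0 < v)%N by rewrite lt0n; apply/eqP=> h; move: y_gt0; rewrite uv h; lia.
have : P v.
  have uvE : (u * u = N * (v * v) + 1)%N by rewrite -zu -zv addn1.
  have ub : (u < (N * (v * v)).+2)%N
    by rewrite ltnS -addn1 -uvE; case: (u) => // k; rewrite leq_pmulr.
  by rewrite /P v0; apply/existsP; exists (Ordinal ub); rewrite /= uvE.
move/ymin; rewrite uv.
have : (v <= u * v)%N by apply: leq_pmull; move: zu; case: (u).
by lia.
Qed.

(** * Squares in finite fields and reciprocity *)

(** Write x = g^k with g a generator of the cyclic group of units, of order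
    2 h: then g^(k h) = 1 forces k to be even. *)
Lemma half_power1_square (F : finFieldType) (x : F) : odd #|F| -> x != 0 ->
  x ^+ #|F|.-1./2 = 1 -> exists y, y ^+ 2 = x.
Proof.
move=> Fodd x0 xh; have F1 : (1 < #|F|)%N := finNzRing_gt1 F.
have [g gE] : exists g : {unit F}, [set: {unit F}]%g = <[g]>%g.
  by apply/cyclicP; exact: (field_unit_group_cyclic [group of [set: {unit F}]%g]).
have ux : x \is a GRing.unit by rewrite unitfE.
have : FinRing.unit F ux \in <[g]>%g by rewrite -gE inE.
case/cycleP=> k /(congr1 val); rewrite FinRing.val_unitX /= => xE.
have : (#[g]%g %| k * #|F|.-1./2)%N.
  rewrite order_dvdn; apply/eqP/val_inj.
  by rewrite FinRing.val_unitX /= exprM -xE xh.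
have -> : #[g]%g = (2 * #|F|.-1./2)%N.
  by rewrite orderE -gE card_finField_unit; lia.
rewrite dvdn_pmul2r; last by lia.
case/dvdnP=> j kE; exists (val g ^+ j); by rewrite -exprM -kE -xE.
Qed.

(** Translating the variable by b multiplies the sum by e b, which is not 1. *)
Lemma sum_additive_character (F : finFieldType) (L : fieldType) (e : F -> L)
    (b a : F) : (forall x y, e (x + y) = e x * e y) -> e 0 = 1 -> e b != 1 ->
  \sum_x e (a * x) = if a == 0 then #|F|%:R else 0.
Proof.
move=> eD e0 eb; case: eqP => [->|/eqP a0].
  rewrite (eq_bigr (fun=> 1)) => [|x _]; last by rewrite mul0r.
  by rewrite sumr_const.
have <- := reindex_inj (mulfI a0) (P := xpredT) (F := e).
set S := \sum_i _; have : S = e b * S.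
  rewrite {1}/S (reindex_inj (addIr b)) /= /S mulr_sumr; apply: eq_bigr => x _.
  by rewrite eD mulrC.
move/eqP; rewrite -subr_eq0 -{1}[S]mul1r -mulrBl mulf_eq0 subr_eq0.
by rewrite [1 == _]eq_sym (negPf eb) => /eqP.
Qed.

(** The Gauss sum g = sum of zeta^(x^2) over x in F_s, with zeta an s-th root of
    unity in an algebraic closure of F_r, satisfies g^2 = s because -1 is a
    square modulo s.  If r = t^2 modulo s, then Frobenius only permutes the
    terms of g, through x |-> t x, so g^r = g and g lies in F_r. *)
Lemma reciprocity_1mod4 (r s : nat) : prime r -> prime s -> r <> s ->
  s = 1 %[mod 4] -> (exists x : 'F_s, x ^+ 2 = r%:R) ->
  exists x : 'F_r, x ^+ 2 = s%:R.
Proof.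
move=> r_pr s_pr rs s4 [t tE].
have [i iE] : exists i : 'F_s, i ^+ 2 = -1.
  apply: half_power1_square; rewrite ?card_Fp ?oppr_eq0 ?oner_eq0 //; first by lia.
  have -> : s.-1./2 = (2 * (s %/ 4))%N by lia.
  by rewrite exprM sqrrN !expr1n.
have [L [/= iota _]] := countable_algebraic_closure 'F_r.
have charL : r \in [pchar L] by rewrite (fmorph_pchar iota) pchar_Fp.
have s_neq0 : s%:R != 0 :> L.
  by rewrite -(dvdn_pcharf charL) dvdn_prime2 //; apply/eqP.
have s2_neq0 : 2%:R != 0 :> 'F_s.
  by rewrite -(dvdn_pcharf (pchar_Fp s_pr)) dvdn_prime2 //; lia.
have [zeta zs z1] : exists2 zeta : L, zeta ^+ s = 1 & zeta != 1.
  pose f : {poly L} := \poly_(i < s) 1.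
  have /closed_rootP[z zf] : size f != 1%N.
    rewrite size_poly_eq ?oner_eq0 //; by have := prime_gt1 s_pr; lia.
  have sumz : \sum_(i < s) z ^+ i = 0.
    move/rootP: zf; rewrite horner_poly => fz; rewrite -[RHS]fz.
    by apply: eq_bigr => k _; rewrite mul1r.
  exists z; first by apply/eqP; rewrite -subr_eq0 subrX1 sumz mulr0.
  apply/eqP=> z1; move/eqP: sumz; rewrite z1 (eq_bigr (fun=> 1)) => [|k _].
    by rewrite sumr_const card_ord (negPf s_neq0).
  by rewrite expr1n.
have [e e_nat] : exists e : 'F_s -> L, forall n, e n%:R = zeta ^+ n.
  by exists (fun x : 'F_s => zeta ^+ val x) => n; rewrite [val _]val_Fp_nat ?expr_mod.
have e_natP x : exists n : nat, x = n%:R :> 'F_s by exists (val x); rewrite natr_Zp.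
have eD x y : e (x + y) = e x * e y.
  have [[n ->] [m ->]] := (e_natP x, e_natP y).
  by rewrite -natrD !e_nat exprD.
have e0 : e 0 = 1 by rewrite (e_nat 0%N).
have e1 : e 1 != 1 by rewrite (e_nat 1%N).
pose g := \sum_(x : 'F_s) e (x ^+ 2).
have gg : g ^+ 2 = s%:R.
  (* Multiplying the variable by i, a square root of -1, negates the exponents. *)
  have gE : g = \sum_(y : 'F_s) e (- y ^+ 2).
    have i0 : i != 0 by rewrite -sqrf_eq0 iE oppr_eq0 oner_eq0.
    rewrite /g (reindex_inj (mulfI i0)) /=.
    by apply: eq_bigr => y _; rewrite exprMn iE mulN1r.
  rewrite expr2 {2}/g mulr_sumr.
  (* Substitute x = a + y, so that x^2 - y^2 = a^2 + 2 a y, and sum over y first. *)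
  transitivity (\sum_(y : 'F_s) \sum_(a : 'F_s) e (a ^+ 2) * e (2%:R * a * y)).
    rewrite {1}gE; under eq_bigr do rewrite mulr_suml.
    rewrite exchange_big; apply: eq_bigr => y _.
    rewrite (reindex_inj (addIr y)) /=; apply: eq_bigr => a _.
    by rewrite -!eD; congr e; ring.
  rewrite exchange_big (bigD1 (0 : 'F_s)) //=.
  rewrite -mulr_sumr (sum_additive_character _ eD e0 e1) mulr0 eqxx expr0n /= e0 mul1r card_Fp //.
  rewrite big1 ?addr0 // => a a0.
  by rewrite -mulr_sumr (sum_additive_character _ eD e0 e1) mulf_eq0 (negPf s2_neq0) (negPf a0) mulr0.
have gr : g ^+ r = g.
  rewrite -(pFrobenius_autE charL) rmorph_sum /=.
  have t0 : t != 0.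
    rewrite -sqrf_eq0 tE -(dvdn_pcharf (pchar_Fp s_pr)) dvdn_prime2 // eq_sym; exact/eqP.
  rewrite /g [RHS](reindex_inj (mulfI t0)) /=; apply: eq_bigr => x _.
  rewrite exprMn tE; have [n ->] := e_natP (x ^+ 2).
  by rewrite pFrobenius_autE -natrM !e_nat -exprM mulnC.
have /eqP : (map_poly iota ('X^#|'F_r| - 'X)).[g] = 0.
  by rewrite rmorphB /= map_polyXn map_polyX !hornerE card_Fp // gr subrr.
rewrite finField_genPoly rmorph_prod horner_prod prodf_seq_eq0 /=.
case/hasP=> x _; rewrite rmorphB /= map_polyX map_polyC !hornerE subr_eq0 => /eqP gx.
by exists x; apply: (fmorph_inj iota); rewrite rmorphXn /= -gx gg rmorph_nat.
Qed.

(** The Legendre symbol of n at l in the form given by Euler's criterion; as an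
    element of F_l it is multiplicative in n by construction. *)
Definition chi (l n : nat) : 'F_l := n%:R ^+ l.-1./2.

Lemma chi1 l : chi l 1 = 1.
Proof. by rewrite /chi expr1n. Qed.

Lemma chiM l m n : chi l (m * n) = chi l m * chi l n.
Proof. by rewrite /chi natrM exprMn. Qed.

Lemma Fp_nat_eq0 l n : prime l -> (n%:R == 0 :> 'F_l) = (l %| n)%N.
Proof. by move=> l_pr; rewrite -(dvdn_pcharf (pchar_Fp l_pr)). Qed.

Lemma fermat_half l (x : 'F_l) : prime l -> odd l -> x != 0 ->
  (x ^+ l.-1./2) ^+ 2 = 1.
Proof.
move=> l_pr lodd x0; rewrite -exprM.
have -> : (l.-1./2 * 2 = l.-1)%N by lia.
apply: (mulfI x0); rewrite -exprS mulr1 prednK ?prime_gt0 //.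
by have := expf_card x; rewrite card_Fp.
Qed.

Lemma chi_sqr l n : prime l -> odd l -> ~~ (l %| n)%N -> chi l n * chi l n = 1.
Proof.
by move=> l_pr lodd ln; rewrite -expr2 fermat_half // Fp_nat_eq0.
Qed.

Lemma chi_sign l n : prime l -> odd l -> ~~ (l %| n)%N ->
  chi l n = 1 \/ chi l n = -1.
Proof.
move=> l_pr lodd ln; have /eqP := chi_sqr l_pr lodd ln.
by rewrite -expr2 sqrf_eq1 => /orP[] /eqP; [left|right].
Qed.

Lemma Fp_N1_neq1 l : prime l -> odd l -> (-1 == 1 :> 'F_l) = false.
Proof.
move=> l_pr lodd; apply/negP; rewrite eq_sym -subr_eq0 opprK -mulr2n Fp_nat_eq0 //.
by rewrite dvdn_prime2 //; lia.
Qed.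

Lemma legendre_chi1 l (n : nat) : prime l -> odd l -> legendre n l = 1 -> chi l n = 1.
Proof.
move=> l_pr lodd; rewrite /legendre -pmulrn; case: eqP => // /eqP n0.
case: ifP => // /existsP[y /eqP yE] _.
rewrite /chi -yE -exprM mulnC exprM fermat_half //.
by rewrite -sqrf_eq0 yE.
Qed.

Lemma legendre_chiN1 l (n : nat) : prime l -> odd l -> legendre n l = -1 ->
  chi l n = -1.
Proof.
move=> l_pr lodd; rewrite /legendre -pmulrn; case: eqP => // /eqP n0.
case: ifP => // nsq _.
have [|h|//] := @chi_sign l n l_pr lodd; first by rewrite -Fp_nat_eq0.
have [||y yE] := half_power1_square _ n0; rewrite ?card_Fp //.
by case/negP: (negbT nsq); apply/existsP; exists y; rewrite yE.
Qed.

(** Modulo a prime dividing D' the equation reads D u^2 = 1. *)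
Lemma descent_chi l D D' u v : prime l -> odd l -> (l %| D')%N ->
  (D * (u * u) = D' * (v * v) + 1)%N -> chi l D = 1.
Proof.
move=> l_pr lodd lD' /(congr1 (fun n => n%:R : 'F_l)).
rewrite natrD !natrM [D'%:R](eqP (_ : _ == 0)) ?Fp_nat_eq0 // mul0r add0r => E.
have u0 : u%:R != 0 :> 'F_l.
  by apply/eqP=> u0; move/eqP: E; rewrite u0 !mulr0 eq_sym oner_eq0.
have : (D%:R * (u%:R * u%:R)) ^+ l.-1./2 = 1 :> 'F_l by rewrite E expr1n.
by rewrite !exprMn -expr2 fermat_half // mulr1.
Qed.

(** Modulo a prime dividing D the equation reads D' v^2 = -1. *)
Lemma descent_chiN l D D' u v : prime l -> odd l -> (l %| D)%N ->
  (D * (u * u) = D' * (v * v) + 1)%N -> chi l D' = (-1) ^+ l.-1./2.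
Proof.
move=> l_pr lodd lD /(congr1 (fun n => n%:R : 'F_l)).
rewrite natrD !natrM [D%:R](eqP (_ : _ == 0)) ?Fp_nat_eq0 // mul0r => /esym E.
have {}E : D'%:R * (v%:R * v%:R) = -1 :> 'F_l by apply/eqP; rewrite -addr_eq0 E.
have v0 : v%:R != 0 :> 'F_l.
  by apply/eqP=> v0; move/eqP: E; rewrite v0 !mulr0 eq_sym oppr_eq0 oner_eq0.
by rewrite -E !exprMn -expr2 fermat_half // mulr1.
Qed.

(** Iterated over the prime factors of N, this enumerates the factorisations
    N = D D'. *)
Lemma split_prime l D D' N : prime l -> (D * D' = l * N)%N ->
  (exists2 E, D = (l * E)%N & (E * D' = N)%N) \/
  (exists2 E, D' = (l * E)%N & (D * E = N)%N).
Proof.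
move=> l_pr E; have l0 := prime_gt0 l_pr.
have : (l %| D * D')%N by rewrite E dvdn_mulr.
rewrite Euclid_dvdM // => /orP[] /dvdnP[k kE]; [left|right]; exists k;
  rewrite 1?mulnC //; subst; apply/eqP; rewrite -(eqn_pmul2l l0) -E; apply/eqP; ring.
Qed.

Lemma nonsquare_prime l m : prime l -> ~~ (l %| m)%N -> nonsquare (l * m).
Proof.
move=> l_pr lm k kE; have : (l %| k)%N.
  have : (l %| k * k)%N by rewrite kE dvdn_mulr.
  by rewrite Euclid_dvdM // orbb.
case/dvdnP=> j jE; subst k; case/negP: lm; apply/dvdnP; exists (j * j)%N.
by apply/eqP; rewrite -(eqn_pmul2l (prime_gt0 l_pr)) -kE; apply/eqP; ring.
Qed.

(** * The divisor produced by the descent *)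

Lemma chi_reciprocity r s : prime r -> prime s -> odd r -> r <> s ->
  s = 1 %[mod 4] -> chi s r = 1 -> chi r s = 1.
Proof.
move=> r_pr s_pr rodd rs s4 sr.
have r0 : r%:R != 0 :> 'F_s.
  by rewrite Fp_nat_eq0 // dvdn_prime2 // eq_sym; apply/eqP.
have s0 : s%:R != 0 :> 'F_r by rewrite Fp_nat_eq0 // dvdn_prime2 //; apply/eqP.
have [|x xs] := reciprocity_1mod4 r_pr s_pr rs s4.
  by apply: half_power1_square; rewrite ?card_Fp //; lia.
rewrite /chi -xs -exprM mulnC exprM fermat_half //.
by rewrite -sqrf_eq0 xs.
Qed.

(** -1 is a square modulo l. *)
Lemma descent_1mod4 l D D' u v : prime l -> l = 1 %[mod 4] -> (l %| D)%N ->
  (D * (u * u) = D' * (v * v) + 1)%N -> chi l D' = 1.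
Proof.
move=> l_pr l4 lD /(descent_chiN l_pr _ lD) ->; last by lia.
have -> : l.-1./2 = (2 * (l %/ 4))%N by lia.
by rewrite exprM sqrrN !expr1n.
Qed.

(** -1 is not a square modulo l, which excludes D = N. *)
Lemma descent_3mod4 l D D' u v : prime l -> l = 3 %[mod 4] -> (l %| D)%N ->
  (D * (u * u) = D' * (v * v) + 1)%N -> D' <> 1%N.
Proof.
move=> l_pr l4 lD E D'1; have lodd : odd l by lia.
have := descent_chiN l_pr lodd lD E; rewrite D'1 chi1.
have -> : l.-1./2 = (2 * (l %/ 4) + 1)%N by lia.
by rewrite exprD exprM sqrrN !expr1n mul1r expr1 => /esym/eqP; rewrite Fp_N1_neq1.
Qed.

Lemma split_prime1 l D D' : prime l -> (D * D' = l)%N ->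
  D = l /\ D' = 1%N \/ D = 1%N /\ D' = l.
Proof.
move=> l_pr E; have l0 := prime_gt0 l_pr.
have : (D %| l)%N by rewrite -E dvdn_mulr.
case/primeP: (l_pr) => _ h /h /orP[] /eqP DE; [right|left]; subst D; split=> //.
  by rewrite -E mul1n.
by apply/eqP; rewrite -(eqn_pmul2l l0) E muln1.
Qed.

(** The descent excludes D = 1, and -1 not being a square modulo p excludes
    D = 2p. *)
Lemma descent_2p p : prime p -> p = 3 %[mod 4] -> exists D D' u v : nat,
  [/\ (D * D' = 2 * p)%N, (D * (u * u) = D' * (v * v) + 1)%N & D = 2 \/ D = p].
Proof.
move=> p_pr p4; have [||D [D' [u [v [DD E D1]]]]] := @pell_descent (2 * p).
- by apply: nonsquare_prime => //; rewrite dvdn_prime2 //; lia.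
- by lia.
exists D, D', u, v; split=> //.
case: (split_prime (isT : prime 2) DD) => -[F FE] /(split_prime1 p_pr)[] [e1 e2]; subst.
- by case: (descent_3mod4 p_pr p4 _ E); rewrite ?dvdn_mull.
- by left.
- by right.
- by [].
Qed.

Ltac dvd_factor :=
  solve [repeat first [exact: dvdnn | exact: dvdn_mulr | apply: dvdn_mull]].

(** Closes a factorisation N = D D' for which the descent equation would make a
    nonsquare modulo l into a square: whichever of H1 and H2 applies, according
    to the side on which l lies, becomes -1 = 1 in F_l, against N. *)
Ltac sign_clash H1 H2 N :=
  first [have := H1 ltac:(dvd_factor) | have := H2 ltac:(dvd_factor)];
  rewrite ?chiM ?chi1;
  repeat match goal with h : chi _ _ = _ |- _ => rewrite ?h; clear h end;
  rewrite ?(mulr1, mul1r, mulrNN, mulN1r, mulrN1, opprK) => /eqP; by rewrite N.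

(** Let E be the one of D and D' that is prime to r.  Its symbol at r is 1
    while p, q, s have symbol -1, so E is 1, pq, ps or qs.  In the last two cases
    the factor prime to s is qr or pr, whose symbol at s is -1.  If E = 1, then
    D is 1 or N, against the descent and p = 3 mod 4. *)
Lemma descent_pqrs p q r s :
  prime p -> prime q -> prime r -> prime s -> uniq [:: p; q; r; s] ->
  p = 3 %[mod 4] -> q = 3 %[mod 4] -> r = 1 %[mod 4] -> s = 1 %[mod 4] ->
  chi r q = -1 -> chi r s = -1 -> chi r p = -1 ->
  chi s p = 1 -> chi s q = 1 -> chi s r = -1 ->
  exists D D' u v : nat,
  [/\ (D * D' = p * (q * (r * s)))%N, (D * (u * u) = D' * (v * v) + 1)%N &
      D = (p * q)%N \/ D = (r * s)%N].
Proof.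
move=> p_pr q_pr r_pr s_pr pqrs_uniq p4 q4 r4 s4 qr sr pr ps qs rs.
have r_odd : odd r by clear -r4; lia.
have s_odd : odd s by clear -s4; lia.
have Nr := Fp_N1_neq1 r_pr r_odd; have Ns := Fp_N1_neq1 s_pr s_odd.
have /and4P[] := pqrs_uniq; rewrite !inE !negb_or => /and3P[pq_ pr_ ps_] /andP[qr_ qs_] rs_ _.
have [||D [D' [u [v [DD E D1]]]]] := @pell_descent (p * (q * (r * s))).
- by apply: nonsquare_prime => //; rewrite !Euclid_dvdM // !dvdn_prime2 // !negb_or pq_ pr_.
- have -> : (p * (q * (r * s)) %% 4 = 1)%N; last by [].
  rewrite -modnMm p4 -(modnMm q) q4 -(modnMm r) r4 s4 //.
exists D, D', u, v; split=> //.
have Hr1 := descent_chi r_pr r_odd _ E; have Hr2 := descent_1mod4 r_pr r4 _ E.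
have Hs1 := descent_chi s_pr s_odd _ E; have Hs2 := descent_1mod4 s_pr s4 _ E.
have Hp := descent_3mod4 p_pr p4 _ E.
case: (split_prime p_pr DD) => -[A AE] {}DD;
  case: (split_prime q_pr DD) => -[B BE] {}DD;
  case: (split_prime r_pr DD) => -[C CE] /(split_prime1 s_pr)[] [e1 e2];
  try (rewrite ?AE ?BE ?CE ?e1 ?e2 ?muln1; by [left|right]).
all: rewrite ?AE ?BE ?CE ?e1 ?e2 in Hr1 Hr2 Hs1 Hs2 Hp D1.
all: first
 [ by case: D1
 | by case: (Hp ltac:(dvd_factor))
 | sign_clash Hr1 Hr2 Nr | sign_clash Hs1 Hs2 Ns].
Qed.

(** The symbol of 2 at r is unknown.  At s the factor prime to s must have
    symbol 1 while 2 and r have symbol -1 and q has symbol 1: it is 1, q, 2r or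
    2qr.  The factors q and 2qr correspond to q and s on the side prime to r, and
    these have symbol -1 at r.  A factor 1 makes D equal to 1 or N, against the
    descent and q = 3 mod 4. *)
Lemma descent_2qrs q r s :
  prime q -> prime r -> prime s ->
  q = 3 %[mod 4] -> r = 1 %[mod 4] -> s = 1 %[mod 4] ->
  chi r q = -1 -> chi r s = -1 -> chi s 2 = -1 -> chi s q = 1 -> chi s r = -1 ->
  exists D D' u v : nat,
  [/\ (D * D' = 2 * (q * (r * s)))%N, (D * (u * u) = D' * (v * v) + 1)%N &
      D = (2 * r)%N \/ D = (q * s)%N].
Proof.
move=> q_pr r_pr s_pr q4 r4 s4 qr sr c2s qs rs.
have q_odd : odd q by clear -q4; lia.
have r_odd : odd r by clear -r4; lia.
have s_odd : odd s by clear -s4; lia.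
have Nr := Fp_N1_neq1 r_pr r_odd; have Ns := Fp_N1_neq1 s_pr s_odd.
have c2r : chi r 2 = 1 \/ chi r 2 = -1.
  by apply: chi_sign; rewrite // dvdn_prime2 //; apply: contraL r_odd => /eqP->.
have [||D [D' [u [v [DD E D1]]]]] := @pell_descent (2 * (q * (r * s))).
- by apply: nonsquare_prime => //; rewrite !Euclid_dvdM // !dvdn_prime2 //; clear -q4 r4 s4; lia.
- have : (q * (r * s) %% 2 = 1)%N; last by lia.
  by rewrite modn2 !oddM q_odd r_odd s_odd.
exists D, D', u, v; split=> //.
have Hr1 := descent_chi r_pr r_odd _ E; have Hr2 := descent_1mod4 r_pr r4 _ E.
have Hs1 := descent_chi s_pr s_odd _ E; have Hs2 := descent_1mod4 s_pr s4 _ E.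
have Hq := descent_3mod4 q_pr q4 _ E.
case: (split_prime (isT : prime 2) DD) => -[A AE] {}DD;
  case: (split_prime q_pr DD) => -[B BE] {}DD;
  case: (split_prime r_pr DD) => -[C CE] /(split_prime1 s_pr)[] [e1 e2];
  try (rewrite ?AE ?BE ?CE ?e1 ?e2 ?muln1; by [left|right]).
all: rewrite ?AE ?BE ?CE ?e1 ?e2 in Hr1 Hr2 Hs1 Hs2 Hq D1.
all: first
 [ by case: D1
 | by case: (Hq ltac:(dvd_factor))
 | sign_clash Hs1 Hs2 Ns
 | by case: c2r => c2r; sign_clash Hr1 Hr2 Nr].
Qed.

(** * Automorphisms of biquadratic fields *)

Lemma nonsquare_rat N (x : rat) : nonsquare N -> x ^+ 2 <> N%:R.
Proof.
move=> Nsq xx; have E : numq x * numq x = N%:Z * (denq x * denq x).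
  apply: (intr_inj (R := rat)); rewrite !intrM -pmulrn -xx numqE.
  by ring.
have co := coprime_num_den x; set n := absz (numq x) in co; set d := absz (denq x) in co.
have {}E : (n * n = N * (d * d))%N.
  by rewrite /n /d -!abszM E abszM.
have d1 : d = 1%N.
  apply/eqP; rewrite -dvdn1 -(@Gauss_dvdr d (n * n)); last first.
    by rewrite coprimeMr [coprime d n]coprime_sym co.
  by rewrite muln1 E mulnA dvdn_mull.
by apply: (Nsq n); rewrite E d1 !muln1.
Qed.

Lemma sqrt_adjoin_mem (K : fieldExtType rat) (E : {subfield K}) (a z : K) :
  a ^+ 2 \in E -> z \in <<E; a>>%VS ->
  exists x y, [/\ x \in E, y \in E & z = x + y * a].
Proof.
move=> a2 /Fadjoin_polyP[p Ep ->]; elim/poly_ind: p Ep => [|p c IH] Ep.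
  by exists 0, 0; split; first [exact: mem0v | rewrite horner0 mul0r addr0].
have pc i : (p * 'X + c%:P)`_i \in E by apply: (polyOverP Ep).
have cE : c \in E by have := pc 0%N; rewrite coefD coefMX coefC add0r.
have pE : p \is a polyOver E.
  by apply/polyOverP=> i; have := pc i.+1; rewrite coefD coefMX coefC addr0.
have [x [y [xE yE pa]]] := IH pE.
exists (c + y * a ^+ 2), x; split=> //; first by apply: rpredD => //; exact: rpredM.
by rewrite hornerMXaddC pa; ring.
Qed.

(** The minimal polynomial of b over E is X^2 - b^2, of which -b is another
    root, so the identity of E extends to E(b) by b |-> -b. *)
Lemma sqrt_automorphism (K : fieldExtType rat) (E : {subfield K}) (b : K) :
  b ^+ 2 \in E -> b \notin E -> <<E; b>>%VS = fullv ->
  exists f : {rmorphism K -> K}, {in E, f =1 id} /\ f b = - b.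
Proof.
move=> b2 bE Kgen; pose g := kHomExtend E \1 b (- b).
have root_g : root (map_poly (\1%VF : 'End(K)) (minPoly E b)) (- b).
  rewrite lfun1_poly; pose P : {poly K} := 'X^2 - (b ^+ 2)%:P.
  have sP : size P = 3%N by rewrite size_XnsubC.
  have PE : P \is a polyOver E by rewrite rpredB ?rpredX ?polyOverX ?polyOverC.
  have rP : root P b by rewrite /root !hornerE subrr.
  have -> : minPoly E b = P.
    apply/eqP; rewrite -eqp_monic ?monic_minPoly ?monicXnsubC //.
    rewrite -dvdp_size_eqp ?minPoly_dvdp // sP size_minPoly eqSS.
    have := dvdp_leq _ (minPoly_dvdp PE rP).
    rewrite sP size_minPoly -size_poly_eq0 sP => /(_ isT).
    have := adjoin_deg_eq1 E b; rewrite (negPf bE).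
    by rewrite /adjoin_degree; case: _.-1 => [|[|n]].
  by rewrite /root !hornerE sqrrN subrr.
have homg := kHomExtendP (sub1v E) (kHom1 1 E) root_g.
have gM : monoid_morphism g by apply/kHom_monoid_morphism; rewrite -Kgen.
pose f0 : K -> K := g.
have f0B : zmod_morphism f0 by move=> x y; rewrite /f0 linearB.
pose fm := GRing.isMonoidMorphism.Build K K f0 gM.
pose fz := GRing.isZmodMorphism.Build K K f0 f0B.
pose f : {rmorphism K -> K} := HB.pack f0 fm fz.
exists f; split=> [x xE|].
  by rewrite /f /= /f0 /g kHomExtend_id ?lfunE.
by rewrite /f /= /f0 /g (kHomExtend_val (kHom1 1 E)).
Qed.

(** What the ideal theory below needs to know about Gal(K/Q), a Klein group
    generated by sigma and tau. *)
Record biquadratic_action (K : fieldExtType rat) (sigma tau : K -> K) : Prop := {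
  act_sK : involutive sigma;
  act_tK : involutive tau;
  act_stC : forall z, sigma (tau z) = tau (sigma z);
  act_fixed : forall z, sigma z = z -> tau z = z -> z \in 1%VS }.

Lemma natr_eq0_field (K : fieldExtType rat) (k : nat) : (k%:R == 0 :> K) = (k == 0%N).
Proof. by rewrite -(rmorph_nat (in_alg K)) fmorph_eq0 pnatr_eq0. Qed.

Section BiquadraticField.
Variables (K : fieldExtType rat) (a b : K) (m n : nat).
Hypotheses (a2 : a ^+ 2 = m%:R) (b2 : b ^+ 2 = n%:R).

Lemma sqrt_notin_base : nonsquare m -> a \notin 1%VS.
Proof.
move=> msq; apply/negP=> /vlineP[x ax]; apply: (@nonsquare_rat m x) => //.
by apply: (fmorph_inj (in_alg K)); rewrite rmorphXn rmorph_nat -a2 ax.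
Qed.

(** If b = x + y a, then b^2 = n has no component along a, so x y = 0; hence
    n = x^2 or n m = (y m)^2. *)
Lemma sqrt_notin_quadratic : nonsquare m -> nonsquare n -> nonsquare (m * n) ->
  b \notin <<1; a>>%VS.
Proof.
move=> msq nsq mnsq; apply/negP=> bE.
have a1 := sqrt_notin_base msq.
have [|_ [_ [/vlineP[x ->] /vlineP[y ->] bxy]]] := @sqrt_adjoin_mem K 1%AS a b _ bE.
  by rewrite a2 rpred_nat.
have E : n%:R = (x ^+ 2 + y ^+ 2 * m%:R)%:A + (2 * x * y)%:A * a.
  have alg (q : rat) : q%:A = in_alg K q by [].
  rewrite -b2 bxy !alg !(rmorphD, rmorphM, rmorphXn, rmorph_nat) -a2.
  by ring.
have xy0 : x * y = 0.
  apply/eqP/negP=> /negP xy; case/negP: a1.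
  have xy2 : (2 * x * y)%:A != 0 :> K.
    by rewrite -[_%:A]/(in_alg K _) fmorph_eq0 -mulrA mulf_neq0.
  have -> : a = (n%:R - (x ^+ 2 + y ^+ 2 * m%:R)%:A) / (2 * x * y)%:A.
    by rewrite E; field.
  by rewrite rpred_div ?rpredB ?rpred_nat ?memvZ ?mem1v.
have {}E : n%:R = x ^+ 2 + y ^+ 2 * m%:R.
  apply: (fmorph_inj (in_alg K)); rewrite rmorph_nat E -mulrA xy0 mulr0 scale0r mul0r addr0 //.
move/eqP: xy0; rewrite mulf_eq0 => /orP[] /eqP h0; subst.
  apply: (@nonsquare_rat (m * n) (y * m%:R)) => //.
  by rewrite natrM E; ring.
by apply: (@nonsquare_rat n x) => //; rewrite E; ring.
Qed.
End BiquadraticField.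

Lemma biquadratic_gen (K : fieldExtType rat) (a b z : K) (m n : nat) :
  a ^+ 2 = m%:R -> b ^+ 2 = n%:R -> <<1 & [:: a; b]>>%VS = fullv ->
  exists x y x' y' : rat, z = x%:A + y%:A * a + (x'%:A + y'%:A * a) * b.
Proof.
move=> a2 b2 Kgen; have zK : z \in <<<<1; a>>; b>>%VS.
  by rewrite -adjoin_seq1 -adjoin_cons Kgen memvf.
have [|u [v [uE vE ->]]] := @sqrt_adjoin_mem K <<1; a>>%AS b z _ zK.
  by rewrite b2 rpred_nat.
have a21 : a ^+ 2 \in 1%AS by rewrite a2 rpred_nat.
have [_ [_ [/vlineP[x ->] /vlineP[y ->] ->]]] := sqrt_adjoin_mem a21 uE.
have [_ [_ [/vlineP[x' ->] /vlineP[y' ->] ->]]] := sqrt_adjoin_mem a21 vE.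
by exists x, y, x', y'.
Qed.

Lemma biquadratic_conjugation (K : fieldExtType rat) (a b : K) (m n : nat) :
  a ^+ 2 = m%:R -> b ^+ 2 = n%:R -> <<1 & [:: a; b]>>%VS = fullv ->
  nonsquare m -> nonsquare n -> nonsquare (m * n) ->
  exists f : {rmorphism K -> K}, f a = a /\ f b = - b.
Proof.
move=> a2 b2 Kgen msq nsq mnsq.
have bE := sqrt_notin_quadratic a2 b2 msq nsq mnsq.
have [|//||f [fE fb]] := @sqrt_automorphism K <<1; a>>%AS b.
- by rewrite b2 rpred_nat.
- by rewrite -Kgen adjoin_cons adjoin_seq1.
- by exists f; split=> //; apply: fE; exact: memv_adjoin.
Qed.

Lemma rmorph_rat_alg (K : fieldExtType rat) (f : {rmorphism K -> K}) (q : rat) :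
  f q%:A = q%:A.
Proof.
by rewrite -[_%:A]/(in_alg K q) -[q]divq_num_den !fmorph_div !rmorph_int.
Qed.

(** The sum of the four conjugates of x + y a + x' b + y' a b is 4 x, so an
    element fixed by sigma and tau is rational. *)
Lemma biquadratic_galois (K : fieldExtType rat) (a b : K) (m n : nat) :
  a ^+ 2 = m%:R -> b ^+ 2 = n%:R -> <<1 & [:: a; b]>>%VS = fullv ->
  nonsquare m -> nonsquare n -> nonsquare (m * n) ->
  exists sigma tau : {rmorphism K -> K},
    [/\ biquadratic_action sigma tau, sigma a = - a /\ sigma b = b
      & tau a = a /\ tau b = - b].
Proof.
move=> a2 b2 Kgen msq nsq mnsq.
have [tau [ta tb]] := biquadratic_conjugation a2 b2 Kgen msq nsq mnsq.
have [||||sigma [sb sa]] := @biquadratic_conjugation K b a n m b2 a2.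
- by rewrite -Kgen !adjoin_cons adjoinC.
- by [].
- by [].
- by rewrite mulnC.
exists sigma, tau; split=> //.
have sq := rmorph_rat_alg sigma; have tq := rmorph_rat_alg tau.
have gen z := biquadratic_gen z a2 b2 Kgen.
split=> z; have [x [y [x' [y' ->]]]] := gen z.
- by rewrite ?(rmorphD, rmorphM, rmorphN, sq, sa, sb) opprK.
- by rewrite ?(rmorphD, rmorphM, rmorphN, tq, ta, tb) opprK.
- by rewrite ?(rmorphD, rmorphM, rmorphN, sq, sa, sb, tq, ta, tb).
- set w := _ + _ => sw tw.
  have -> : w = x%:A.
    have four : 4%:R != 0 :> K by rewrite natr_eq0_field.
    apply: (mulfI four); have -> : 4%:R * w = w + sigma w + tau w + sigma (tau w).
      by rewrite tw sw; ring.
    by rewrite /w ?(rmorphD, rmorphM, rmorphN, sq, sa, sb, tq, ta, tb); ring.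
  by rewrite memvZ ?mem1v.
Qed.

(** * Maximal ideals: products, norms, automorphisms *)

Local Open Scope classical_set_scope.

Section MaximalIdeals.
Variable R : comNzRingType.
Implicit Types (M J : set R) (x y : R).

Lemma idealrP J : idealr_closed [in J] <->
  [/\ J 0, ~ J 1 & forall a u v, J u -> J v -> J (a * u + v)].
Proof.
have inJ x : (x \in [in J]) = (x \in J) by [].
split=> -[h0 h1 hD]; split.
- by move: h0; rewrite inJ in_setE.
- by move=> J1; move: h1; rewrite inJ mem_set.
- by move=> a u v Ju Jv; have := hD a u v; rewrite !inJ !in_setE; exact.
- by rewrite inJ in_setE.
- by apply/negP; rewrite inJ in_setE.
- by move=> a u v; rewrite !inJ !in_setE; exact: hD.
Qed.

(** The sum M + J either is the whole ring or, by maximality, equals M. *)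
Lemma maximal_adjoin M J : maximal_ideal M -> J 0 ->
  (forall a u v, J u -> J v -> J (a * u + v)) ->
  J `<=` M \/ exists m n, [/\ M m, J n & 1 = m + n].
Proof.
move=> [/idealrP[M0 M1 MD] Mmax] J0 JD.
pose S := [set x | exists2 m, M m & exists2 n, J n & x = m + n].
have [[m Mm [n Jn e]]|S1] := EM (S 1); first by right; exists m, n.
left => x Jx; have -> : M = S.
  apply/esym/Mmax.
    apply/idealrP; split=> //; first by exists 0 => //; exists 0; rewrite ?addr0.
    move=> a _ _ [m Mm [n Jn ->]] [m' Mm' [n' Jn' ->]].
    by exists (a * m + m'); [exact: MD|exists (a * n + n'); [exact: JD|ring]].
  by move=> y My; exists y => //; exists 0; rewrite ?addr0.
by exists 0 => //; exists x; rewrite ?add0r.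
Qed.

Lemma maximal_prime M x y : maximal_ideal M -> M (x * y) -> M x \/ M y.
Proof.
move=> Mmax Mxy; have [/idealrP[M0 M1 MD] _] := Mmax.
have [||xM|[m [n [Mm [k nE] e]]]] := @maximal_adjoin M [set z | exists k, z = k * x] Mmax.
- by exists 0; rewrite mul0r.
- by move=> a _ _ [k ->] [k' ->]; exists (a * k + k'); ring.
- by left; apply: xM; exists 1; rewrite mul1r.
- right; have -> : y = y * m + (k * (x * y) + 0) by rewrite -{1}[y]mulr1 e nE; ring.
  by apply: (MD _ _ _) => //; exact: MD.
Qed.

Lemma maximal_prime_exp M x n : maximal_ideal M -> M (x ^+ n) -> M x.
Proof.
move=> Mmax; have [/idealrP[M0 M1 MD] _] := Mmax.
by elim: n => [//|n IH]; rewrite exprS => /(maximal_prime Mmax)[].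
Qed.

Lemma maximal_comaximal M J : maximal_ideal M -> maximal_ideal J -> M <> J ->
  exists m n, [/\ M m, J n & 1 = m + n].
Proof.
move=> Mmax Jmax MJ; have [Jideal Jsub] := Jmax.
have /idealrP[J0 _ JD] := Jideal.
have [JM|//] := maximal_adjoin Mmax J0 JD.
by case: MJ; apply: Jsub JM; case: Mmax.
Qed.

(** Multiply relations 1 = m + n, one for each member of s. *)
Lemma maximal_comaximal_seq M (s : seq (set R)) : maximal_ideal M ->
  {in s, forall J, maximal_ideal J} -> M \notin s ->
  exists m n, [/\ M m, {in s, forall J, J n} & 1 = m + n].
Proof.
move=> Mmax; have [/idealrP[M0 _ MD] _] := Mmax.
elim: s => [|J s IH] smax; first by exists 0, 1; rewrite add0r.
rewrite inE negb_or => /andP[/eqP MJ Ms].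
have Jmax : maximal_ideal J by apply: smax; rewrite inE eqxx.
have [|//|m [n [Mm sn e]]] := IH; first by move=> I Is; apply: smax; rewrite inE Is orbT.
have [m' [n' [Mm' Jn' e']]] := maximal_comaximal Mmax Jmax MJ.
exists (n' * m + m'), (n' * n); split; first exact: MD.
  move=> I; rewrite inE => /orP[/eqP->|Is].
    have [/idealrP[J0 _ JD] _] := Jmax; rewrite mulrC -[_ * _]addr0; exact: JD.
  have [|/idealrP[I0 _ ID] _] := smax I; first by rewrite inE Is orbT.
  by rewrite -[_ * _]addr0; apply: ID => //; exact: sn.
by rewrite e' -[n' in LHS]mulr1 e; ring.
Qed.

(** A product lies in each of its factors.  Conversely, if 1 = m + n with m in M
    and n in all members of s, then x = m x + x n belongs to the product of M
    with the intersection over s as soon as x lies in all of them. *)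
Lemma prod_maximal (s : seq (set R)) : uniq s ->
  {in s, forall M, maximal_ideal M} ->
  \big[@ideal_mul R/setT]_(M <- s) M = [set x | {in s, forall M, M x}].
Proof.
elim: s => [|M s IH] /= => [_ _|/andP[Ms us] smax].
  by rewrite big_nil; apply/seteqP; split.
have sm J : J \in s -> maximal_ideal J by move=> Js; apply: smax; rewrite inE Js orbT.
have Mmax : maximal_ideal M by apply: smax; rewrite inE eqxx.
have ideal J : J \in M :: s -> J 0 /\ forall a u v, J u -> J v -> J (a * u + v).
  by move/smax=> [/idealrP[]].
rewrite big_cons IH //; apply/seteqP; split=> x /=.
  case=> t ts -> J Js; have [J0 JD] := ideal J Js.
  elim: t ts => [|[u v] t IHt] ts; first by rewrite big_nil.
  have [Mu sv] : M u /\ {in s, forall J, J v} by apply: (ts (u, v)); rewrite inE eqxx.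
  rewrite big_cons /=; have {}IHt : J (\sum_(w <- t) w.1 * w.2).
    by apply: IHt => w wt; apply: ts; rewrite inE wt orbT.
  move: Js; rewrite inE => /orP[/eqP JM|/sv Jv]; last exact: JD.
  by rewrite mulrC; apply: JD => //; rewrite JM.
move=> sx; have [m [n [Mm sn e]]] := maximal_comaximal_seq Mmax sm Ms.
exists [:: (m, x); (x, n)].
  move=> w; rewrite !inE => /orP[] /eqP-> /=; split=> //.
    by move=> J Js; apply: sx; rewrite inE Js orbT.
  by apply: sx; rewrite inE eqxx.
by rewrite big_cons big_seq1 /= mulrC -mulrDr -e mulr1.
Qed.
End MaximalIdeals.

Section Norms.
Variable R : comNzRingType.
Implicit Types (M : set R) (x y : R).

Lemma coset_eqP M x y : idealr_closed [in M] ->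
  [set x + z | z in M] = [set y + z | z in M] <-> M (x - y).
Proof.
move=> /idealrP[M0 _ MD]; split=> [e|Mxy].
  have : [set y + z | z in M] x by rewrite -e; exists 0; rewrite ?addr0.
  by case=> z Mz <-; rewrite addrC addKr.
have MN z : M z -> M (- z).
  by move=> Mz; rewrite -mulN1r -[_ * z]addr0; exact: MD.
have MA u v : M u -> M v -> M (u + v) by move=> *; rewrite -[u]mul1r; exact: MD.
apply/seteqP; split=> _ [z Mz <-].
  by exists (x - y + z); [exact: MA|ring].
by exists (- (x - y) + z); [apply: MA => //; exact: MN|ring].
Qed.

(** The additive order of 1 divides the number of cosets.  Concretely, adding 1
    permutes the n cosets; summing representatives over all cosets before and
    after the translation shows that the sum of n ones lies in M. *)
Lemma norm_mem M n : idealr_closed [in M] -> has_norm M n -> M n%:R.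
Proof.
move=> Mid /card_set_bijP[f [fn finj fsurj]]; have [M0 _ MD] := (idealrP M).1 Mid.
pose coset x := [set x + z | z in M].
have cosetP x : cosets M (coset x) by exists x.
have cl x : (f (coset x) < n)%N by apply: fn; exact: cosetP.
have rep (i : 'I_n) : exists x, f (coset x) = i.
  by have [C [x _ <-] fC] := fsurj i (ltn_ord i); exists x.
pose g i := projT1 (cid (rep i)).
have gE i : f (coset (g i)) = i by rewrite /g; case: cid.
pose h (i : 'I_n) : 'I_n := Ordinal (cl (g i + 1)).
have f_eq x y : f (coset x) = f (coset y) <-> M (x - y).
  split=> [e|Mxy]; last by congr f; apply/coset_eqP.
  by apply/(coset_eqP _ _ Mid); apply: finj => //; apply: mem_set; exact: cosetP.
have h_inj : injective h.
  move=> i j /(congr1 val) /= /f_eq; rewrite opprD addrACA subrr addr0 => /f_eq.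
  by rewrite !gE => /val_inj.
have : M (\sum_(i < n) (g i + 1 - g (h i))).
  elim/big_ind: _ => [//|x y Mx My|i _]; first by rewrite -[x]mul1r; exact: MD.
  by apply/f_eq; rewrite gE.
rewrite sumrB big_split /= -(reindex_inj h_inj (P := xpredT) (F := g)).
by rewrite addrAC subrr add0r sumr_const card_ord.
Qed.

Variable g : {rmorphism R -> R}.
Hypothesis gK : involutive g.

Lemma preimage_ideal M : idealr_closed [in M] -> idealr_closed [in g @^-1` M].
Proof.
move=> /idealrP[M0 M1 MD]; apply/idealrP; rewrite /preimage /=; split.
- by rewrite rmorph0.
- by rewrite rmorph1.
- by move=> a u v; rewrite rmorphD rmorphM; exact: MD.
Qed.

Lemma preimageK M : g @^-1` (g @^-1` M) = M.
Proof. by rewrite predeqE /preimage /= => x; rewrite gK. Qed.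

Lemma preimage_maximal M : maximal_ideal M -> maximal_ideal (g @^-1` M).
Proof.
move=> [Mid Mmax]; split=> [|J Jid MJ]; first exact: preimage_ideal.
rewrite -[J]preimageK (Mmax (g @^-1` J)) //; first exact: preimage_ideal.
by move=> x Mx; apply: MJ; rewrite /preimage /= gK.
Qed.

Lemma preimage_norm M n : has_norm M n -> has_norm (g @^-1` M) n.
Proof.
rewrite /has_norm => Mn; apply: card_eq_trans Mn.
have -> : cosets M = (fun C => g @` C) @` cosets (g @^-1` M).
  have img x : g @` [set x + z | z in g @^-1` M] = [set g x + z | z in M].
    apply/seteqP; split=> [_ [_ [z Mz <-] <-]|_ [z Mz <-]].
      by exists (g z) => //; rewrite rmorphD.
    exists (x + g z); last by rewrite rmorphD gK.
    by exists (g z) => //; rewrite /preimage /= gK.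
  apply/seteqP; split=> [_ [x _ <-]|_ [_ [x _ <-] <-]].
    by exists [set g x + z | z in g @^-1` M]; [exists (g x)|rewrite img gK].
  by exists (g x); rewrite ?img.
apply/card_esym/inj_card_eq => C D _ _ e; apply/seteqP; split=> x Cx.
  have : (g @` D) (g x) by rewrite -e; exists x.
  by case=> y Dy /(can_inj gK) <-.
have : (g @` C) (g x) by rewrite e; exists x.
by case=> y Dy /(can_inj gK) <-.
Qed.
End Norms.

(** * Integral elements and Galois-stable ideals *)

Section IntegralElements.
Variable K : fieldExtType rat.
Local Notation O := (@integral_over_Z K).

Lemma integral_int (k : int) : k%:~R \in O. Proof. exact: rpred_int. Qed.

Lemma integral_sqr (z : K) : z ^+ 2 \in O -> z \in O.
Proof.
move=> /asboolP z2; apply/asboolP.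
apply: (@integral_root_monic _ _ _ z ('X^2 - (z ^+ 2)%:P)).
- by rewrite monicXnsubC.
- by rewrite /root !hornerE subrr.
- move=> c /(nthP 0)[i _ <-]; rewrite coefB coefXn coefC.
  apply: integral_sub; first exact: integral_nat.
  by case: ifP => // _; exact: integral0.
Qed.

Lemma integral_rmorph_mem (f : {rmorphism K -> K}) (z : K) : z \in O -> f z \in O.
Proof.
move=> /asboolP[p p_mon pz]; apply/asboolP; exists p => //.
have -> : map_poly (intr : int -> K) p = map_poly f (map_poly intr p).
  by rewrite -map_poly_comp; apply: eq_map_poly => k /=; rewrite rmorph_int.
exact: rmorph_root.
Qed.

(** Gauss's lemma: the factor X - x of a monic integer polynomial is a rational
    multiple of an integer polynomial, whose leading coefficient is then a
    unit. *)
Lemma integral_rat (z : K) : z \in O -> z \in 1%VS -> exists k : int, z = k%:~R.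
Proof.
move=> /asboolP[p p_mon pz] /vlineP[x zx].
have px : root (map_poly (intr : int -> rat) p) x.
  rewrite -(fmorph_root (in_alg K)) -map_poly_comp /= zx in pz *.
  rewrite (_ : map_poly _ p = map_poly intr p) //.
  by apply: eq_map_poly => k /=; rewrite scaler_int.
have : 'X - x%:P %| map_poly (intr : int -> rat) p by rewrite dvdp_XsubCl.
case/dvdpP_rat_int=> p1 [c c0 xE] [u pE].
have c1 : c * (p1`_1)%:~R = 1.
  by have := congr1 (coefp 1%N) xE; rewrite /= coefB coefX coefC subr0 coefZ coef_map.
have c2 : c * (p1`_0)%:~R = - x.
  by have := congr1 (coefp 0%N) xE; rewrite /= coefB coefX coefC sub0r coefZ coef_map.
have sp1 : size p1 = 2%N.
  by rewrite -(size_map_inj_poly (@intr_inj rat) (rmorph0 _)) -(size_scale _ c0) -xE size_XsubC.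
have unit1 : p1`_1 * lead_coef u = 1.
  by rewrite -[p1`_1]/(p1`_(2.-1)) -sp1 -lead_coefE -lead_coefM -pE (monicP p_mon).
have cE : c = (lead_coef u)%:~R.
  transitivity (c * (p1`_1)%:~R * (lead_coef u)%:~R); last by rewrite c1 mul1r.
  by rewrite -mulrA -intrM unit1 mulr1.
exists (- (lead_coef u * p1`_0)); rewrite zx -[x]opprK -c2 cE -intrM -mulrNz.
by rewrite scaler_int.
Qed.

Lemma integral_coprime (m l : nat) (z : K) : coprime m l ->
  m%:R * z \in O -> l%:R * z \in O -> z \in O.
Proof.
move=> co mz lz; have [u [v uv]] : exists u v : int, u * m%:Z + v * l%:Z = 1.
  by have [u [v uv]] := Bezoutz m l; exists u, v; rewrite uv /gcdz /= (eqP co).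
have -> : z = u%:~R * (m%:R * z) + v%:~R * (l%:R * z).
  rewrite !pmulrn !mulrA -!intrM -mulrDl -intrD uv mul1r //.
by apply: rpredD; apply: rpredM => //; exact: integral_int.
Qed.

(** With delta = om - tau om, the element z is recovered from its traces by
    delta z = (om z + tau (om z)) - tau om (z + tau z).  Multiplying by delta
    gives m z, where m = delta^2 is prime to l.  This expresses that the
    extension is unramified above l. *)
Lemma trace_reduction (tau : K -> K) (om gam z : K) (m l : nat) :
  om \in O -> tau om \in O -> (om - tau om) ^+ 2 = m%:R -> coprime m l ->
  z \in O -> l%:R / gam \in O ->
  (z + tau z) / gam \in O -> (om * z + tau om * tau z) / gam \in O ->
  z / gam \in O.
Proof.
move=> omO tomO dm co zO lg t1 t2.
have dO : om - tau om \in O by rewrite rpredB.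
apply: (integral_coprime co); last first.
  by rewrite mulrCA rpredM.
have -> : m%:R * (z / gam) = (om - tau om) *
    ((om * z + tau om * tau z) / gam - tau om * ((z + tau z) / gam)).
  by rewrite -dm; ring.
by rewrite rpredM // rpredB // rpredM.
Qed.

(** An ideal of the ring of integers, seen inside K, which is stable under the
    Galois group and meets Z inside lZ. *)
Record stable_ideal (sigma tau : K -> K) (l : nat) (J : K -> Prop) : Prop := {
  stable_int : forall z, J z -> z \in O;
  stable_add : forall z w, J z -> J w -> J (z + w);
  stable_mul : forall w z, w \in O -> J z -> J (w * z);
  stable_s : forall z, J z -> J (sigma z);
  stable_t : forall z, J z -> J (tau z);
  stable_Z : forall k : int, J k%:~R -> (l %| k)%Z }.

Lemma biquadratic_action_sym (sigma tau : K -> K) :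
  biquadratic_action sigma tau -> biquadratic_action tau sigma.
Proof. by case=> sK tK stC fixed; split=> // z *; apply: fixed. Qed.

Variables sigma tau : {rmorphism K -> K}.
Hypothesis act : biquadratic_action sigma tau.
Variables (l : nat) (J : K -> Prop).
Hypothesis l_gt0 : (0 < l)%N.
Hypothesis Jstable : stable_ideal sigma tau l J.

Lemma stable_rational z : J z -> sigma z = z -> tau z = z ->
  exists k : int, z = (k * l)%:~R.
Proof.
move=> Jz sz tz; have [k zk] := integral_rat (stable_int Jstable Jz) (act_fixed act sz tz).
by rewrite zk in Jz *; have /dvdzP[j ->] := stable_Z Jstable Jz; exists j.
Qed.

Let l_neq0 : l%:R != 0 :> K.
Proof. by rewrite natr_eq0_field; lia. Qed.

(** z is a root of X^2 - T X + N, where the trace T and the norm N lie in J and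
    in Z, hence in lZ; so z^2 = T z - N is divisible by l. *)
Lemma stable_quadratic z : J z -> tau z = z -> z ^+ 2 / l%:R \in O.
Proof.
move=> Jz tz; have zO := stable_int Jstable Jz.
have [|||i iE] := @stable_rational (z + sigma z).
- by apply: (stable_add Jstable) => //; exact: (stable_s Jstable).
- by rewrite rmorphD (act_sK act) addrC.
- by rewrite rmorphD -(act_stC act) tz.
have [|||j jE] := @stable_rational (z * sigma z).
- by apply: (stable_mul Jstable) => //; exact: (stable_s Jstable).
- by rewrite rmorphM (act_sK act) mulrC.
- by rewrite rmorphM -(act_stC act) tz.
have -> : z ^+ 2 / l%:R = i%:~R * z - j%:~R.
  apply: (mulIf l_neq0); rewrite mulfVK //.
  have -> : z ^+ 2 = (z + sigma z) * z - z * sigma z by ring.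
  by rewrite iE jE !intrM; ring.
by rewrite rpredB ?rpredM ?integral_int.
Qed.

(** The relative traces t, t' of z lie in the quadratic field fixed by tau,
    where (t / gam)^2 = (t^2 / l) e is integral. *)
Lemma ramified_stable (om gam e : K) (m : nat) : e \in O ->
  l%:R = gam ^+ 2 * e -> om \in O -> (om - tau om) ^+ 2 = m%:R -> coprime m l ->
  forall z, J z -> z / gam \in O.
Proof.
move=> eO gamE omO dm co z Jz.
have [gam0 e0] : gam != 0 /\ e != 0.
  by move: l_neq0; rewrite gamE mulf_eq0 expf_eq0 /= negb_or => /andP[].
have step t : J t -> tau t = t -> t / gam \in O.
  move=> Jt tt; apply: integral_sqr.
  have -> : (t / gam) ^+ 2 = (t ^+ 2 / l%:R) * e by rewrite gamE; field; rewrite gam0 e0.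
  by rewrite rpredM ?stable_quadratic.
have tomO := integral_rmorph_mem tau omO.
apply: (trace_reduction omO tomO dm co (stable_int Jstable Jz)).
- apply: integral_sqr; have -> : (l%:R / gam) ^+ 2 = l%:R * e.
    by rewrite gamE; field.
  by rewrite rpredM ?rpred_nat.
- apply: step; last by rewrite rmorphD (act_tK act) addrC.
  by apply: (stable_add Jstable) => //; exact: (stable_t Jstable).
- apply: step; last by rewrite rmorphD !rmorphM !(act_tK act) addrC.
  apply: (stable_add Jstable); apply: (stable_mul Jstable) => //.
  exact: (stable_t Jstable).
Qed.

(** Trace down twice, from K to the field fixed by tau and then to Q, where J
    consists of multiples of l. *)
Lemma unramified_stable (om om' : K) (m m' : nat) :
  om \in O -> (om - tau om) ^+ 2 = m%:R -> coprime m l ->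
  om' \in O -> tau om' = om' -> (om' - sigma om') ^+ 2 = m'%:R -> coprime m' l ->
  forall z, J z -> z / l%:R \in O.
Proof.
move=> omO dm co omO' tom' dm' co' z Jz.
have ll : l%:R / l%:R \in O by rewrite divff ?rpred1.
have rat t : J t -> sigma t = t -> tau t = t -> t / l%:R \in O.
  move=> Jt st tt; have [k ->] := stable_rational Jt st tt.
  by rewrite intrM mulfK ?integral_int.
have somO' := integral_rmorph_mem sigma omO'.
have step t : J t -> tau t = t -> t / l%:R \in O.
  move=> Jt tt; apply: (trace_reduction omO' somO' dm' co' (stable_int Jstable Jt) ll).
  - apply: rat; [|by rewrite rmorphD (act_sK act) addrC|].
      by apply: (stable_add Jstable) => //; exact: (stable_s Jstable).
    by rewrite rmorphD -(act_stC act) tt.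
  - apply: rat; last by rewrite rmorphD !rmorphM -!(act_stC act) tt tom'.
      apply: (stable_add Jstable); apply: (stable_mul Jstable) => //.
      exact: (stable_s Jstable).
    by rewrite rmorphD !rmorphM !(act_sK act) addrC.
have tomO := integral_rmorph_mem tau omO.
apply: (trace_reduction omO tomO dm co (stable_int Jstable Jz) ll).
- apply: step; last by rewrite rmorphD (act_tK act) addrC.
  by apply: (stable_add Jstable) => //; exact: (stable_t Jstable).
- apply: step; last by rewrite rmorphD !rmorphM !(act_tK act) addrC.
  apply: (stable_add Jstable); apply: (stable_mul Jstable) => //.
  exact: (stable_t Jstable).
Qed.
End IntegralElements.

(** * Ostrowski ideals of biquadratic fields *)

Section IntegerAutomorphism.
Variables (K : fieldExtType rat) (f : {rmorphism K -> K}).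

Definition integer_aut (x : integers K) : integers K :=
  Integers (integral_rmorph_mem f (integers_valP x)).

Fact integer_aut_zmod : zmod_morphism integer_aut.
Proof. by move=> x y; apply: val_inj; rewrite /= !rmorphB. Qed.

Fact integer_aut_monoid : monoid_morphism integer_aut.
Proof.
split=> [|x y]; apply: val_inj; first by rewrite /= !rmorph1.
by rewrite /= !rmorphM.
Qed.

HB.instance Definition _ :=
  GRing.isZmodMorphism.Build (integers K) (integers K) integer_aut integer_aut_zmod.
HB.instance Definition _ :=
  GRing.isMonoidMorphism.Build (integers K) (integers K) integer_aut integer_aut_monoid.

Lemma integer_autK : involutive f -> involutive integer_aut.
Proof. by move=> fK x; apply: val_inj; rewrite /= fK. Qed.
End IntegerAutomorphism.

Section OstrowskiIdeals.
Variables (K : fieldExtType rat) (sigma tau : {rmorphism K -> K}).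
Hypothesis act : biquadratic_action sigma tau.
Local Notation O := (@integral_over_Z K).

(** The bound on stable ideals is applied to the intersection of the maximal
    ideals of norm l^f; it contains gam because every such ideal is prime and
    contains l, hence gam^2.  When there is no such ideal, or infinitely many,
    the big operator is the unit ideal. *)
Lemma ostrowski_principal (l f : nat) (gam : K) : prime l ->
  gam != 0 -> gam \in O -> gam ^+ 2 / l%:R \in O ->
  (forall J, stable_ideal sigma tau l J -> forall z, J z -> z / gam \in O) ->
  principal_ideal (ostrowski_ideal K l f).
Proof.
move=> l_pr gam0 gamO gam2 Jgam.
have unit_principal : principal_ideal (setT : set (integers K)).
  by exists 1; apply/seteqP; split=> // x _; exists x; rewrite ?mul1r.
rewrite /ostrowski_ideal; case: finite_supportP => [_|X _ _ XE].
  by rewrite big_nil.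
set S := [set M : set (integers K) | maximal_ideal M /\ _] in XE.
have {}XE M : M \in (X : seq (set (integers K))) <-> S M.
  have -> : (M \in (X : seq (set (integers K)))) = (M \in X) by [].
  split=> [MX|SM]; first by have : [set` X] M := MX; rewrite XE => -[].
  suff h : [set` X] M by exact: h.
  rewrite XE; split=> //= MT; case: SM => -[/idealrP[_ M1 _] _] _.
  by apply: M1; rewrite MT.
rewrite prod_maximal ?fset_uniq //; last by move=> M /XE[].
have [XN0|[M0 SM0]] : (forall M, ~ S M) \/ exists M, S M.
- by have [|/forallNP] := EM (exists M, S M); [right|left].
- rewrite (_ : [set x | _] = setT) //; apply/seteqP; split=> // x _ M /XE SM.
  by case: (XN0 M).
set I := [set x | _].
have IE x : I x <-> forall M, S M -> M x by split=> Ix M /XE; exact: Ix.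
(* The ideal contains its norm l^f, hence l because it is prime. *)
have mem_l M : S M -> M l%:R.
  case=> Mmax Mn; have [Mid _] := Mmax.
  by apply: (maximal_prime_exp Mmax (n := f)); rewrite -natrX; exact: norm_mem.
have Sstable (g : {rmorphism integers K -> integers K}) M :
    involutive g -> S M -> S (g @^-1` M).
  by move=> gK [Mmax Mn]; split; [exact: preimage_maximal|exact: preimage_norm].
pose J z := exists2 x : integers K, integers_val x = z & I x.
have Jst : stable_ideal sigma tau l J.
  have Ifix (g : {rmorphism K -> K}) z : involutive g -> J z -> J (g z).
    move=> gK [x <- /IE Ix]; exists (integer_aut g x) => //; apply/IE => M SM.
    exact: (Ix _ (Sstable (integer_aut g) M (integer_autK gK) SM)).
  have SD M : S M -> forall a u v, M u -> M v -> M (a * u + v).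
    by case=> -[/idealrP[]].
  split.
  - by move=> _ [x <- _]; exact: integers_valP.
  - move=> _ _ [x <- /IE Ix] [y <- /IE Iy]; exists (x + y) => //; apply/IE=> M SM.
    by rewrite -[x]mul1r; apply: SD; [|exact: Ix|exact: Iy].
  - move=> w _ wO [x <- /IE Ix]; exists (Integers wO * x) => //; apply/IE=> M SM.
    rewrite -[_ * x]addr0; apply: SD; [by []|exact: Ix|].
    by case: SM => -[/idealrP[]].
  - by move=> z; apply: Ifix; exact: act_sK act.
  - by move=> z; apply: Ifix; exact: act_tK act.
  - move=> k [x xk /IE Ix]; have {}xk : x = k%:~R.
      by apply: val_inj; rewrite [RHS]rmorph_int.
    have Mk := Ix _ SM0; rewrite {}xk in Mk.
    rewrite dvdzE; apply/negP=> /negP lk; have [[/idealrP[_ M1 _] _] _] := SM0.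
    have co : coprime l `|k| by rewrite prime_coprime.
    have [u [v uv]] := Bezoutz l k; apply: M1.
    have -> : 1 = u%:~R * l%:R + (v%:~R * k%:~R + 0) :> integers K.
      by rewrite addr0 pmulrn -!intrM -intrD uv /gcdz /= (eqP co).
    apply: (SD _ SM0); first exact: mem_l.
    by apply: (SD _ SM0) => //; case: SM0 => -[/idealrP[]].
exists (Integers gamO); apply/seteqP; split=> [x Ix|_ [x _ <-]].
  have xg : integers_val x / gam \in O by apply: (Jgam J) => //; exists x.
  by exists (Integers xg) => //; apply: val_inj; rewrite /= mulrC divfK.
apply/IE=> M SM; have [Mmax _] := SM; have [/idealrP[M0' _ MD] _] := Mmax.
rewrite mulrC -[_ * _]addr0; apply: (MD _ _ _) => //.
apply: (maximal_prime_exp Mmax (n := 2)).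
have -> : Integers gamO ^+ 2 = Integers gam2 * l%:R + 0.
  have l0 : l%:R != 0 :> K by rewrite natr_eq0_field -lt0n prime_gt0.
  apply: val_inj; rewrite addr0 [LHS]rmorphXn [RHS]rmorphM.
  by rewrite [X in _ = _ * X]rmorph_nat /= divfK.
by apply: (MD _ _ _) => //; exact: mem_l.
Qed.
End OstrowskiIdeals.

Section SquareTimesUnit.
Variable K : fieldExtType rat.
Local Notation O := (@integral_over_Z K).

(** For a prime l ramified with index 2 everywhere, this says that the product of
    the primes above l, whose square is (l), is principal. *)
Definition square_times_unit (x : K) : Prop :=
  x != 0 /\ exists g e, [/\ e \in O, e^-1 \in O & x = g ^+ 2 * e].

Lemma square_times_unitX2 (g : K) : g != 0 -> square_times_unit (g ^+ 2).
Proof.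
by move=> g0; split; [rewrite expf_neq0|exists g, 1; split; rewrite ?invr1 ?mulr1 ?rpred1].
Qed.

Lemma square_times_unitM x y :
  square_times_unit x -> square_times_unit y -> square_times_unit (x * y).
Proof.
move=> [x0 [g [e [eO eVO xE]]]] [y0 [g' [e' [eO' eVO' yE]]]].
split; first by rewrite mulf_neq0.
exists (g * g'), (e * e'); rewrite invfM !rpredM //; split=> //.
by rewrite xE yE; ring.
Qed.

Lemma square_times_unitV x : square_times_unit x -> square_times_unit x^-1.
Proof.
move=> [x0 [g [e [eO eVO xE]]]]; split; first by rewrite invr_eq0.
by exists g^-1, e^-1; rewrite invrK xE invfM exprVn.
Qed.

(** With t = D u^2 + D' v^2 and w = 2 u v c one has (D u + v c)^2 = D (t + w),
    and t + w has inverse t - w because t^2 - w^2 = (D u^2 - D' v^2)^2 = 1. *)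
Lemma descent_square_times_unit (N D D' u v : nat) (c : K) : (0 < N)%N ->
  (D * D' = N)%N -> (D * (u * u) = D' * (v * v) + 1)%N -> c ^+ 2 = N%:R ->
  square_times_unit D%:R.
Proof.
move=> N0 DD uv c2; have cO : c \in O by apply: integral_sqr; rewrite c2 rpred_nat.
have D0 : D%:R != 0 :> K.
  by rewrite natr_eq0_field; apply: contraTneq N0 => D0; rewrite -DD D0.
pose t : K := D%:R * u%:R ^+ 2 + D'%:R * v%:R ^+ 2.
pose w : K := 2%:R * u%:R * v%:R * c.
have norm1 : (t + w) * (t - w) = 1.
  have uvK : D%:R * u%:R ^+ 2 = D'%:R * v%:R ^+ 2 + 1 :> K.
    by rewrite -!natrX -!natrM natr1 -!mulnn uv addn1.
  have -> : (t + w) * (t - w) = t ^+ 2 - 4%:R * u%:R ^+ 2 * v%:R ^+ 2 * c ^+ 2.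
    by rewrite /w; ring.
  have -> : c ^+ 2 = D%:R * D'%:R by rewrite c2 -DD natrM.
  have -> : t ^+ 2 - 4%:R * u%:R ^+ 2 * v%:R ^+ 2 * (D%:R * D'%:R) =
            (D%:R * u%:R ^+ 2 - D'%:R * v%:R ^+ 2) ^+ 2 by rewrite /t; ring.
  by rewrite uvK addrC addKr expr1n.
have tw : (t - w)^-1 = t + w.
  have tw0 : t - w != 0 by apply/eqP=> h; move/eqP: norm1; rewrite h mulr0 eq_sym oner_eq0.
  by apply: (mulIf tw0); rewrite mulVf.
have tO : t \in O by rewrite rpredD ?rpredM ?rpredX ?rpred_nat.
have wO : w \in O by rewrite ?rpredM ?rpred_nat.
split=> //; exists (D%:R * u%:R + v%:R * c), (t - w); split.
- by rewrite rpredB.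
- by rewrite tw rpredD.
- have -> : (D%:R * u%:R + v%:R * c) ^+ 2 = D%:R * (t + w).
    have -> : (D%:R * u%:R + v%:R * c) ^+ 2 =
      D%:R * (D%:R * u%:R ^+ 2 + w) + v%:R ^+ 2 * c ^+ 2 by rewrite /w; ring.
    by rewrite c2 -DD natrM /t; ring.
  by rewrite -mulrA norm1 mulr1.
Qed.

Variables sigma tau : {rmorphism K -> K}.
Hypothesis act : biquadratic_action sigma tau.

Lemma ramified_ostrowski (l f : nat) (om : K) (m : nat) : prime l ->
  square_times_unit l%:R -> om \in O -> (om - tau om) ^+ 2 = m%:R ->
  coprime m l -> principal_ideal (ostrowski_ideal K l f).
Proof.
move=> l_pr [l0 [gam [e [eO eVO lE]]]] omO dm co.
have [gam0 e0] : gam != 0 /\ e != 0.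
  by move: l0; rewrite lE mulf_eq0 expf_eq0 /= negb_or => /andP[].
apply: (@ostrowski_principal K sigma tau act l f gam) => //.
- apply: integral_sqr; have -> : gam ^+ 2 = l%:R * e^-1 by rewrite lE mulfK.
  by rewrite rpredM ?rpred_nat.
- by rewrite lE invfM mulrA divff ?mul1r // expf_neq0.
- move=> J Jst; apply: (ramified_stable act _ Jst eO lE omO dm co).
  exact: prime_gt0.
Qed.

Lemma unramified_ostrowski (l f : nat) (om om' : K) (m m' : nat) : prime l ->
  om \in O -> (om - tau om) ^+ 2 = m%:R -> coprime m l ->
  om' \in O -> tau om' = om' -> (om' - sigma om') ^+ 2 = m'%:R -> coprime m' l ->
  principal_ideal (ostrowski_ideal K l f).
Proof.
move=> l_pr omO dm co omO' tom' dm' co'.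
have l0 : l%:R != 0 :> K by rewrite natr_eq0_field -lt0n prime_gt0.
apply: (@ostrowski_principal K sigma tau act l f l%:R) => //.
- by rewrite rpred_nat.
- by rewrite expr2 mulfK ?rpred_nat.
- move=> J Jst; apply: (unramified_stable act _ Jst omO dm co omO' tom' dm' co').
  exact: prime_gt0.
Qed.
End SquareTimesUnit.

(** It is a root of X^2 - X - (N - 1) / 4. *)
Lemma half_integral (K : fieldExtType rat) (c : K) (N : nat) :
  c ^+ 2 = N%:R -> N = 1 %[mod 4] -> (1 + c) / 2%:R \in @integral_over_Z K.
Proof.
move=> c2 N4; have [k NE] : exists k, N = (4 * k + 1)%N by exists (N %/ 4)%N; lia.
have two0 : 2%:R != 0 :> K by rewrite natr_eq0_field.
have four0 : 4%:R != 0 :> K by rewrite natr_eq0_field.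
apply/asboolP; apply: (@integral_root_monic _ _ _ _ ('X^2 - ('X + k%:R%:P))).
- by rewrite monicE lead_coefDl ?lead_coefXn // size_polyN size_XaddC size_polyXn.
- apply/eqP; rewrite hornerD hornerN hornerXn hornerD hornerX hornerC.
  have c2k : c ^+ 2 = 4%:R * k%:R + 1 by rewrite c2 NE natrD natrM.
  have -> : ((1 + c) / 2%:R) ^+ 2 = (1 + 2%:R * c + c ^+ 2) / 4%:R.
    by field; rewrite ?two0 ?four0.
  by rewrite c2k; field; rewrite ?two0 ?four0.
- move=> x /(nthP 0)[i _ <-]; rewrite coefB coefD coefXn coefX coefC.
  apply: integral_sub; first exact: integral_nat.
  apply: integral_add; first exact: integral_nat.
  by case: ifP => _; [exact: integral_nat | exact: integral0].
Qed.

Theorem theorem5 (p q r s : nat)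
    (p_prime : prime p) (q_prime : prime q)
    (r_prime : prime r) (s_prime : prime s)
    (pqrs_distinct : uniq [:: p; q; r; s])
    (p_mod4 : p = 3 %[mod 4]) (q_mod4 : q = 3 %[mod 4])
    (r_mod4 : r = 1 %[mod 4]) (s_mod4 : s = 1 %[mod 4])
    (K : fieldExtType rat) (a b : K)
    (a_sqr : a ^+ 2 = (2 * p)%:R)
    (b_sqr : b ^+ 2 = (2 * q * r * s)%:R)
    (K_gen : <<1 & [:: a; b]>>%VS = fullv)
    (leg_2s : legendre 2 s = -1) (leg_qr : legendre q r = -1)
    (leg_sr : legendre s r = -1) (leg_pr : legendre p r = -1)
    (leg_qs : legendre q s = 1) (leg_ps : legendre p s = 1) :
  polya_field K.
Proof.
have rodd : odd r by clear -r_mod4; lia.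
have sodd : odd s by clear -s_mod4; lia.
have [p2 q2 r2 s2] : [/\ 2 != p, 2 != q, 2 != r & 2 != s]%N.
  by clear -p_mod4 q_mod4 r_mod4 s_mod4; split; lia.
have /and4P[] := pqrs_distinct; rewrite !inE !negb_or.
move=> /and3P[pq pr ps] /andP[qr qs] rs _.
have rs_neq : r <> s by apply/eqP.
have qr' := legendre_chiN1 r_prime rodd leg_qr.
have sr' := legendre_chiN1 r_prime rodd leg_sr.
have pr' := legendre_chiN1 r_prime rodd leg_pr.
have ps' := legendre_chi1 s_prime sodd leg_ps.
have qs' := legendre_chi1 s_prime sodd leg_qs.
have c2s : chi s 2 = -1 := legendre_chiN1 s_prime sodd leg_2s.
(* The symbol (r/s) comes from (s/r) by reciprocity. *)
have rs' : chi s r = -1.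
  have [|/(chi_reciprocity r_prime s_prime rodd rs_neq s_mod4) h|//] := @chi_sign s r s_prime sodd.
    by rewrite dvdn_prime2 // eq_sym.
  by move/eqP: sr'; rewrite h eq_sym Fp_N1_neq1.

have bE : b ^+ 2 = (2 * (q * (r * s)))%:R by rewrite b_sqr !mulnA.
have nsq_a : nonsquare (2 * p) by apply: nonsquare_prime; rewrite // dvdn_prime2.
have nsq_b : nonsquare (2 * (q * (r * s))).
  by apply: nonsquare_prime; rewrite // !Euclid_dvdM // !dvdn_prime2 // !negb_or q2 r2.
have nsq_ab : nonsquare (2 * p * (2 * (q * (r * s)))).
  have -> : (2 * p * (2 * (q * (r * s))) = p * (2 * (2 * (q * (r * s)))))%N by ring.
  by apply: nonsquare_prime; rewrite // !Euclid_dvdM // !dvdn_prime2 // !negb_or pq pr ps [p == 2]eq_sym p2.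
have [sigma [tau [act [sa sb] [ta tb]]]] :=
  biquadratic_galois a_sqr bE K_gen nsq_a nsq_b nsq_ab.
(* A square root of pqrs, negated by tau. *)
pose c := a * b / 2%:R.
have n0 n : (0 < n)%N -> n%:R != 0 :> K by rewrite natr_eq0_field lt0n.
have [two0 four0] : 2%:R != 0 :> K /\ 4%:R != 0 :> K by rewrite !n0.
have cE : c ^+ 2 = (p * (q * (r * s)))%:R.
  have -> : c ^+ 2 = a ^+ 2 * b ^+ 2 / 4%:R by rewrite /c; field; rewrite ?two0 ?four0.
  by rewrite a_sqr bE !natrM; field; rewrite ?two0 ?four0.
have tc : tau c = - c by rewrite /c fmorph_div rmorphM ta tb rmorph_nat mulrN mulNr.
have [p0 q0 r0 s0] : [/\ 0 < p, 0 < q, 0 < r & 0 < s]%N by rewrite !prime_gt0.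
pose U n := square_times_unit (n%:R : K).
have U_sqr n (z : K) : (0 < n)%N -> z ^+ 2 = n%:R -> U n.
  move=> n_gt0 zn; rewrite /U -zn; apply: square_times_unitX2.
  by rewrite -sqrf_eq0 zn n0.
have U_div m n : (0 < m)%N -> U m -> U (m * n)%N -> U n.
  move=> m0 Um Umn; have := square_times_unitM (square_times_unitV Um) Umn.
  by rewrite natrM mulKf ?n0.
have Ua : U (2 * p)%N by apply: U_sqr a_sqr; rewrite muln_gt0.
have Ub : U (2 * (q * (r * s)))%N by apply: U_sqr bE; rewrite !muln_gt0 q0 r0 s0.
have Uc : U (p * (q * (r * s)))%N by apply: U_sqr cE; rewrite !muln_gt0 p0 q0 r0 s0.
have U_descent N D (z : K) : (0 < N)%N -> z ^+ 2 = N%:R ->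
    (exists D' u v, (D * D' = N)%N /\ (D * (u * u) = D' * (v * v) + 1)%N) -> U D.
  by move=> N0 zN [D' [u [v [DD uv]]]]; exact: descent_square_times_unit N0 DD uv zN.
(* D is 2 or p, and 2p is a square. *)
have [U2 Up] : U 2 /\ U p.
  have [D [D' [u [v [DD uv De]]]]] := descent_2p p_prime p_mod4.
  have UD : U D by apply: U_descent a_sqr _; [rewrite muln_gt0|exists D', u, v].
  case: De UD => -> UD; split=> //; first exact: (@U_div 2).
  by apply: (@U_div p); rewrite // mulnC.
have Ub' : U (q * (r * s))%N by exact: (@U_div 2).
(* D is 2r or qs, and 2 and 2qrs are already known. *)
have [Ur Uqs] : U r /\ U (q * s)%N.
  have [D [D' [u [v [DD uv De]]]]] := descent_2qrs q_prime r_prime s_prime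
    q_mod4 r_mod4 s_mod4 qr' sr' c2s qs' rs'.
  have UD : U D by apply: U_descent bE _; [rewrite !muln_gt0 q0 r0 s0|exists D', u, v].
  case: De UD => -> UD; split=> //.
  - exact: (@U_div 2).
  - apply: (@U_div r) => //; first exact: (@U_div 2).
    by rewrite mulnCA.
  - by apply: (@U_div (q * s)); rewrite ?muln_gt0 ?q0 // -mulnA [(s * r)%N]mulnC.
(* D is pq or rs, and p and pqrs are already known. *)
have Uq : U q.
  have [D [D' [u [v [DD uv De]]]]] := descent_pqrs p_prime q_prime r_prime s_prime
    pqrs_distinct p_mod4 q_mod4 r_mod4 s_mod4 qr' sr' pr' ps' qs' rs'.
  have UD : U D by apply: U_descent cE _; [rewrite !muln_gt0 p0 q0 r0 s0|exists D', u, v].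
  case: De UD => -> UD; first exact: (@U_div p).
  by apply: (@U_div (r * s)); rewrite ?muln_gt0 ?r0 // mulnC.
have Us : U s by exact: (@U_div q).
have [aO bO] : a \in @integral_over_Z K /\ b \in @integral_over_Z K.
  by split; apply: integral_sqr; rewrite ?a_sqr ?b_sqr rpred_nat.
have da : (a - sigma a) ^+ 2 = (8 * p)%:R.
  have -> : (a - sigma a) ^+ 2 = 4%:R * a ^+ 2 by rewrite sa; ring.
  by rewrite a_sqr -natrM; congr _%:R; ring.
have db : (b - tau b) ^+ 2 = (8 * (q * (r * s)))%:R.
  have -> : (b - tau b) ^+ 2 = 4%:R * b ^+ 2 by rewrite tb; ring.
  by rewrite bE -natrM; congr _%:R; ring.
move=> l f l_pr _.
have act' := biquadratic_action_sym act.
have co n : (~~ (l %| n))%N -> coprime n l by rewrite coprime_sym prime_coprime.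
have co8 n : l != 2 -> (~~ (l %| n))%N -> coprime (8 * n) l.
  move=> l2 ln; apply: co; rewrite Euclid_dvdM // negb_or ln andbT.
  by rewrite -[8%N]/(2 ^ 3)%N Euclid_dvdX // dvdn_prime2 // andbT.
(* Above 2, K is unramified over Q(a): (1 + c) / 2 generates it locally. *)
have [l2|l2] := eqVneq l 2.
  apply: (ramified_ostrowski act f (om := (1 + c) / 2%:R) (m := p * (q * (r * s)))) => //.
  - by rewrite l2.
  - apply: half_integral cE _.
    by rewrite -modnMm p_mod4 -(modnMm q) q_mod4 -(modnMm r) r_mod4 s_mod4.
  - have -> : (1 + c) / 2%:R - tau ((1 + c) / 2%:R) = c.
      by rewrite fmorph_div rmorphD rmorph1 rmorph_nat tc; field; rewrite ?two0 ?four0.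
    by [].
  - by apply: co; rewrite l2 !Euclid_dvdM // !dvdn_prime2 // !negb_or p2 q2 r2.
(* Above p, K is unramified over Q(a): use b, with discriminant 8qrs. *)
have [lp|lp] := eqVneq l p.
  apply: (ramified_ostrowski act f l_pr _ bO db); first by rewrite lp.
  by apply: co8; rewrite // lp !Euclid_dvdM // !dvdn_prime2 // !negb_or pq pr ps.
(* Above q, r and s, K is unramified over Q(b): use a, with discriminant 8p. *)
have [lqrs|lqrs] := boolP (l \in [:: q; r; s]).
  apply: (ramified_ostrowski act' f l_pr _ aO da).
    by move: lqrs; rewrite !inE => /or3P[] /eqP->.
  by apply: co8; rewrite // dvdn_prime2.
apply: (unramified_ostrowski act f l_pr bO db _ aO ta da).
  apply: co8; rewrite // !Euclid_dvdM // !dvdn_prime2 //.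
  by move: lqrs; rewrite !inE.
by apply: co8; rewrite // dvdn_prime2.
Qed.
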